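(* Let $\tau$ be a complex number with $\mathrm{Im}(\tau)>0$ and let $q=e^{\pi i\tau}$ (so $|q|<1$). For every positive integer $n$, \[ \prod_{k=1}^{n-1}\Gamma_q\left(\frac{k}{n}\right) = \Big(\Gamma_q\big(\tfrac{1}{2}\big)\Big)^{n-1} \frac{f^{n-1}(-q^{\frac{1}{2}})}{f^{n-2}(-q)\, f(-q^{\frac{1}{n}})}. \] Moreover, this identity is a $q$-analogue of Gauss's formula $\prod_{k=1}^{n-1}\Gamma(k/n)=(2\pi)^{\frac{n-1}{2}}/\sqrt{n}$: as $q\to 1^-$ through real values in $(0,1)$, the right-hand side tends to $(2\pi)^{\frac{n-1}{2}}/\sqrt{n}$.
   Context: For a complex number $a$ and $|p|<1$, $(a;p)_\infty=\prod_{i=0}^{\infty}(1-ap^i)$. Fractional powers of $q$ are defined via $\tau$: $q^{c}=e^{\pi i\tau c}$ for real $c$ (for real $0<q<1$ these are the usual positive powers). Ramanujan's function $f$ is given by $f(-p)=(p;p)_\infty$, so $f(-q^{c})=(q^{c};q^{c})_\infty$. The $q$-gamma function is $\Gamma_q(z)=\dfrac{(q;q)_\infty}{(q^{z};q)_\infty}(1-q)^{1-z}$, with the principal branch for $(1-q)^{1-z}$. $\Gamma$ denotes the Euler gamma function. *)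

(* Defs.v *)
From HB Require Import structures.
From mathcomp Require Import all_boot all_order all_algebra.
From mathcomp Require Import complex.
From mathcomp Require Import all_classical all_reals all_analysis.

Set Implicit Arguments.
Unset Strict Implicit.
Unset Printing Implicit Defensive.

Import Order.TTheory GRing.Theory Num.Theory.
Import numFieldNormedType.Exports.

Local Open Scope classical_set_scope.
Local Open Scope ring_scope.
Local Open Scope complex_scope.

Definition cexp (R : realType) (z : R[i]) : R[i] :=
  (expR (complex.Re z))%:C * (cos (complex.Im z) +i* sin (complex.Im z)).

(* The argument in ]-pi, pi] of a nonzero complex number. *)
Definition carg (R : realType) (z : R[i]) : R :=
  let t := acos (complex.Re z / Num.sqrt (complex.Re z ^+ 2 + complex.Im z ^+ 2)) in
  if 0 <= complex.Im z then t else - t.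

(* The principal branch, for z != 0. *)
Definition clog (R : realType) (z : R[i]) : R[i] :=
  ln (Num.sqrt (complex.Re z ^+ 2 + complex.Im z ^+ 2)) +i* carg z.

Definition cpow (R : realType) (a z : R[i]) : R[i] := cexp (z * clog a).

(* q^z = e^(pi i tau z); fractional powers of q depend on tau, not only on the
   value of q = q^1. *)
Definition qpow (R : realType) (tau z : R[i]) : R[i] :=
  cexp ((0 +i* pi) * tau * z).

(* (a; p)_oo.  The alias ^o gives R[i] the topology of its modulus. *)
Definition qpoch (R : realType) (a p : R[i]) : R[i] :=
  limn (fun m => \prod_(0 <= j < m) (1 - a * p ^+ j) : (R[i])^o).

(* f(-p) = (p; p)_oo *)
Definition ramanujan_f (R : realType) (x : R[i]) : R[i] := qpoch (- x) (- x).

Definition qGamma (R : realType) (tau z : R[i]) : R[i] :=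
  let q := qpow tau 1 in
  qpoch q q / qpoch (qpow tau z) q * cpow (1 - q) (1 - z).

(* The exponent of f(-q) is an integer: it is -1 when n = 1. *)
Definition qGauss_rhs (R : realType) (n : nat) (tau : R[i]) : R[i] :=
  qGamma tau (1 / 2) ^+ (n - 1) *
  (ramanujan_f (- qpow tau (1 / 2)) ^+ (n - 1) /
   (ramanujan_f (- qpow tau 1) ^ (n%:Z - 2) *
    ramanujan_f (- qpow tau (1 / n%:R)))).

(* The purely imaginary tau with e^(pi i tau) = q, for 0 < q < 1. *)
Definition tau_of (R : realType) (q : R) : R[i] := 0 +i* (- ln q / pi).

(* For this tau the fractional powers of q are the usual positive ones. *)
Lemma qpow_tau_of (R : realType) (q c : R) :
  0 < q -> qpow (tau_of q) c%:C = (q `^ c)%:C.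
Proof.
move=> q0; have pi0 : pi != 0 :> R by rewrite gt_eqF// pi_gt0.
have -> : qpow (tau_of q) c%:C = cexp (c * ln q)%:C.
  rewrite /qpow /tau_of; congr cexp; apply/eqP; rewrite eq_complex /=.
  rewrite !(mulr0, mul0r, mulr1, subr0, addr0, add0r, sub0r, oppr0).
  by rewrite mulrC [pi * _]mulrC divfK// opprK !eqxx.
rewrite /cexp /= cos0 sin0 /powR gt_eqF//.
by apply/eqP; rewrite eq_complex /= !(mulr0, mul0r, mulr1, subr0, addr0) !eqxx.
Qed.

Definition Euler_Gamma (R : realType) (x : R) : R :=
  \int[lebesgue_measure]_(t in `]0, +oo[) (t `^ (x - 1) * expR (- t)).

Definition Gauss_value (R : realType) (n : nat) : R :=
  (2 * pi) `^ ((n%:R - 1) / 2) / Num.sqrt n%:R.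

(* Main.v *)
Require Import Defs.
From mathcomp Require Import all_boot all_order all_algebra.
From mathcomp Require Import complex ring lra zify.
From mathcomp Require Import all_classical all_reals all_analysis.
From mathcomp Require Import measurable_realfun.

(* For the product formula, splitting (s; s)_oo with s = q^(1/n) along residue
   classes modulo n gives (s; s)_oo = prod_(1 <= k <= n) (q^(k/n); q)_oo; the
   cases n and 2 of this identity turn both sides into the same quotient.

   For the limit, log-concavity of z |-> 1 - q^z bounds Gamma_q(x), 0 < x < 1,
   between q-analogues of Gauss's approximations N! N^(x - 1) / (x)_N, up to a
   factor [N]_q / [N + 1]_q.  The arithmetic-geometric inequality under the
   integral sign bounds Gamma(x) in the same way, hence Gamma_q(x) tends to
   Gamma(x).

   The product of Gauss's approximations at x = k/n is a quotient of factorials,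
   so Stirling's formula gives Gauss's product up to the value of Stirling's
   constant, which the case n = 2 and the Gaussian integral determine. *)

Set Implicit Arguments.
Unset Strict Implicit.
Unset Printing Implicit Defensive.

Import Order.TTheory GRing.Theory Num.Theory.
Import numFieldNormedType.Exports ComplexField.Normc.

Local Open Scope classical_set_scope.
Local Open Scope ring_scope.
Local Open Scope complex_scope.

(** * Infinite products *)

Section cexp.
Variable R : realType.
Implicit Types z w : R[i].

(** The obstacle in the limit is that [qGamma] is itself a limit of partial products, and that as q
    tends to 1 the products (q; q)_oo and (q^x; q)_oo both tend to 0, so neither can be treated
    alone. The bounds are therefore proved for a fixed number N of leading factors, uniformly in the
    number of further factors. N is chosen from the tolerance, and q tends to 1 only afterwards, in
    finitely many factors; limits are never interchanged. The quotient of values of f needs no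
    asymptotics of its own: the product formula at [tau_of q] replaces it by n - 1 values of
    Gamma_q, each with a known limit. A single inequality, weighted AM-GM, serves both sides:
    applied to powers of q it bounds Gamma_q(x), applied under the integral it bounds Gamma(x). *)

Lemma cexpD z w : cexp (z + w) = cexp z * cexp w.
Proof.
case: z w => [a b] [c d]; rewrite /cexp /= expRD cosD sinD.
by apply/eqP; rewrite eq_complex /=; apply/andP; split; apply/eqP; ring.
Qed.

Lemma cexp0 : cexp 0 = 1 :> R[i].
Proof.
rewrite /cexp /= expR0 cos0 sin0.
by apply/eqP; rewrite eq_complex /= !(mulr0, mul0r, mulr1, subr0, addr0) !eqxx.
Qed.

Lemma cexp_sum (I : Type) (r : seq I) (P : pred I) (F : I -> R[i]) :
  cexp (\sum_(i <- r | P i) F i) = \prod_(i <- r | P i) cexp (F i).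
Proof. exact: (big_morph _ cexpD cexp0). Qed.

Lemma cexpMn z n : cexp (z *+ n) = cexp z ^+ n.
Proof. by elim: n => [|n IHn]; rewrite ?cexp0// mulrS exprS cexpD IHn. Qed.

Lemma normc_cexp z : normc (cexp z) = expR (complex.Re z).
Proof.
rewrite /cexp normcM /= expr0n /= addr0 sqrtr_sqr ger0_norm ?expR_ge0//.
by rewrite cos2Dsin2 sqrtr1 mulr1.
Qed.

Lemma qpowMn (tau z : R[i]) n : qpow tau (z *+ n) = qpow tau z ^+ n.
Proof. by rewrite /qpow mulrnAr cexpMn. Qed.

Lemma normc_qpow_lt1 (tau : R[i]) (c : R) :
  0 < complex.Im tau -> 0 < c -> normc (qpow tau c%:C) < 1.
Proof.
move=> t0 c0; rewrite /qpow normc_cexp; case: tau t0 => a b /= b0;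
  rewrite expR_lt1.
rewrite !(mul0r, mulr0, subr0, addr0, add0r, sub0r) mulNr oppr_lt0.
by rewrite !mulr_gt0// pi_gt0.
Qed.

End cexp.

(** Each [i < n * m] is [k + n * j] with [k < n]. After the exchange of the two products, the
    induction on [m] appends one block of [n] consecutive indices. This serves the q-products as
    well as the factorial of [n * N]. *)
Lemma prod_dissect (K : comPzRingType) (F : nat -> K) n m :
  \prod_(0 <= i < n * m) F i =
  \prod_(0 <= k < n) \prod_(0 <= j < m) F (k + n * j)%N.
Proof.
rewrite exchange_big_nat /=; elim: m => [|m IHm].
  by rewrite muln0 !big_geq.
rewrite big_nat_recr//= -IHm mulnS addnC (big_cat_nat (n := (n * m)%N))//=;
  last first.
  exact: leq_addr.
by congr (_ * _); rewrite -{1}[(n * m)%N]add0n big_addn addnC addnK.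
Qed.

Section prod_limits.
Variable K : numFieldType.

Lemma cvg_big_prod (I : Type) (r : seq I) (P : pred I) (T : Type)
    (F : set_system T) {FF : Filter F} (f : I -> T -> K) (l : I -> K) :
  (forall i, P i -> f i x @[x --> F] --> l i) ->
  (\prod_(i <- r | P i) f i x) @[x --> F] --> \prod_(i <- r | P i) l i.
Proof. by move=> fl; apply: cvg_big => //; exact: mul_continuous. Qed.

(** Along the subsequence [n * m] the partial products split exactly, so uniqueness of limits
    suffices. The convergence hypothesis is used at [k = 1] for the left side and at [k = n] for the
    right side. *)
Lemma lim_prod_dissect (a s : K) n : (0 < n)%N ->
  (forall b k, (0 < k)%N ->
     cvgn (fun m => \prod_(0 <= j < m) (1 - b * (s ^+ k) ^+ j) : K)) ->
  limn (fun m => \prod_(0 <= j < m) (1 - a * s ^+ j) : K) =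
  \prod_(0 <= k < n)
    limn (fun m => \prod_(0 <= j < m) (1 - (a * s ^+ k) * (s ^+ n) ^+ j) : K).
Proof.
move=> n0 cv.
have c1 := cv a 1%N isT; rewrite expr1 in c1.
apply: (@cvg_unique _ (@norm_hausdorff K K^o)
   ((fun m => \prod_(0 <= j < n * m) (1 - a * s ^+ j) : K) @ \oo)).
  apply: (@cvg_comp _ _ _ (muln n)
    (fun m => \prod_(0 <= j < m) (1 - a * s ^+ j) : K)); last exact: c1.
  exact: cvg_mulnl.
rewrite (_ : (fun m => _) = fun m => \prod_(0 <= k < n)
    \prod_(0 <= j < m) (1 - (a * s ^+ k) * (s ^+ n) ^+ j)); last first.
  apply/funext => m; rewrite prod_dissect; apply: eq_bigr => k _.
  by apply: eq_bigr => j _; rewrite exprD exprM mulrA.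
by apply: cvg_big_prod => k _; exact: cv.
Qed.

Lemma prod_tail (a p : K) m n :
  \prod_(0 <= j < m + n) (1 - a * p ^+ j) =
  \prod_(0 <= j < m) (1 - a * p ^+ j) *
  \prod_(0 <= j < n) (1 - (a * p ^+ m) * p ^+ j).
Proof.
rewrite (big_cat_nat (n := m))//= ?leq_addr//; congr (_ * _).
rewrite -{1}[m]add0n big_addn addnC addnK; apply: eq_bigr => i _.
by rewrite -mulrA -exprD addnC.
Qed.

Lemma lim_prod_tail (a p : K) m :
  cvgn (fun n => \prod_(0 <= j < n) (1 - (a * p ^+ m) * p ^+ j) : K) ->
  limn (fun n => \prod_(0 <= j < n) (1 - a * p ^+ j) : K) =
  \prod_(0 <= j < m) (1 - a * p ^+ j) *
  limn (fun n => \prod_(0 <= j < n) (1 - (a * p ^+ m) * p ^+ j) : K).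
Proof.
move=> cv; apply: (@cvg_lim K^o); first exact: (@norm_hausdorff K K^o).
rewrite -(cvg_shiftn m).
rewrite (_ : (fun n => _) = fun n => \prod_(0 <= j < m) (1 - a * p ^+ j) *
    \prod_(0 <= j < n) (1 - (a * p ^+ m) * p ^+ j)); last first.
  by apply/funext => n /=; rewrite addnC prod_tail.
by apply: cvgM; [exact: cvg_cst|exact: cv].
Qed.

Lemma lim_neq0 (u : K^nat) (c : K) :
  0 < c -> (forall n, c <= `|u n|) -> cvgn u -> limn u != 0.
Proof.
move=> c0 cu /cvgrPdist_lt /(_ _ c0)[n _ /(_ n (leqnn _))] /=.
by apply: contraTneq => ->; rewrite sub0r normrN le_gtF.
Qed.

End prod_limits.

(** * Convergence and nonvanishing of complex q-products *)

Section complex_limits.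
Variable R : realType.

Lemma norm_normc (z : R[i]) : `|z| = (normc z)%:C.
Proof. by []. Qed.

Lemma normc_real (x : R) : normc x%:C = `|x|.
Proof. by rewrite /= expr0n /= addr0 sqrtr_sqr. Qed.

Lemma normc_le_ReIm (z : R[i]) : normc z <= `|complex.Re z| + `|complex.Im z|.
Proof.
case: z => a b /=; rewrite -[leRHS]ger0_norm ?addr_ge0//
  -sqrtr_sqr ler_wsqrtr//.
rewrite sqrrD -addrA [_ *+ 2 + _]addrC addrA !real_normK ?num_real// lerDl.
by rewrite mulrn_wge0// mulr_ge0.
Qed.

Lemma Re_le_normc (z : R[i]) : `|complex.Re z| <= normc z.
Proof. by case: z => a b /=; rewrite -sqrtr_sqr ler_wsqrtr// lerDl sqr_ge0. Qed.

Lemma Im_le_normc (z : R[i]) : `|complex.Im z| <= normc z.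
Proof. by case: z => a b /=; rewrite -sqrtr_sqr ler_wsqrtr// lerDr sqr_ge0. Qed.

Lemma normcX (z : R[i]) n : normc (z ^+ n) = normc z ^+ n.
Proof. by elim: n => [|n IHn]; rewrite ?normc1// !exprS normcM IHn. Qed.

Lemma cvg_complex (T : Type) (F : set_system T) {FF : Filter F}
    (u v : T -> R) (a b : R) :
  u @ F --> a -> v @ F --> b ->
  (fun x => u x +i* v x : (R[i])^o) @ F --> (a +i* b : (R[i])^o).
Proof.
move=> ua vb; apply/cvgrPdist_lt => -[e e'].
(* A positive element of [R[i]] has imaginary part 0, so the tolerance is a real [e]. *)
rewrite ltcE /= => /andP[/eqP -> e0].
have e2 : 0 < e / 2 by rewrite divr_gt0.
move/cvgrPdist_lt : ua => /(_ _ e2) ua; move/cvgrPdist_lt : vb => /(_ _ e2) vb.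
near=> x.
have h1 : `|a - u x| < e / 2 by near: x.
have h2 : `|b - v x| < e / 2 by near: x.
rewrite [ltLHS]norm_normc complexr0 ltcR (le_lt_trans (normc_le_ReIm _))//=.
by rewrite [e]splitr ltrD.
Unshelve. all: by end_near. Qed.

Lemma cvg_real_complex (T : Type) (F : set_system T) {FF : Filter F}
    (u : T -> R) (a : R) :
  u @ F --> a -> (fun x => (u x)%:C : (R[i])^o) @ F --> (a%:C : (R[i])^o).
Proof. by move=> ua; apply: cvg_complex => //; exact: cvg_cst. Qed.

(** The increments form an absolutely convergent series, and its partial sums telescope to
    [u n - u 0]. *)
Lemma cvg_geometric_increments (u : R^nat) (c r : R) : 0 <= r < 1 ->
  (forall n, `|u n.+1 - u n| <= c * r ^+ n) -> cvgn u.
Proof.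
move=> /andP[r0 r1] ur.
have : cvgn [normed series (fun n => u n.+1 - u n)].
  apply: (@series_le_cvg _ _ (geometric c r)) => //= [n|].
  - exact: le_trans (ur n).
  - by apply: is_cvg_geometric_series; rewrite ger0_norm.
move=> /normed_cvg; rewrite /series /=.
under eq_fun do rewrite telescope_sumr//.
move=> cu; rewrite (_ : u = (fun n => (u n - u 0) + u 0)); last first.
  by apply/funext => n; rewrite subrK.
by apply: is_cvgD => //; exact: is_cvg_cst.
Qed.

Definition qpoch_part (a p : R[i]) (m : nat) : R[i] :=
  \prod_(0 <= j < m) (1 - a * p ^+ j).

Lemma normc_ge0 (z : R[i]) : 0 <= normc z.
Proof. by case: z => x y; exact: sqrtr_ge0. Qed.

Lemma geometric_sum_le (r : R) m : 0 <= r < 1 ->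
  \sum_(0 <= j < m) r ^+ j <= (1 - r)^-1.
Proof.
move=> /andP[r0 r1]; have r1' : 0 < 1 - r by rewrite subr_gt0.
rewrite -[leRHS]mul1r ler_pdivlMr// (_ : _ * _ = 1 - r ^+ m).
  by rewrite lerBlDr lerDl exprn_ge0.
elim: m => [|m IHm]; first by rewrite big_geq// mul0r expr0 subrr.
by rewrite big_nat_recr//= mulrDl IHm exprSr; ring.
Qed.

(** Each factor has modulus at most 1 + |a| |p|^j <= exp(|a| |p|^j). The bound does not depend on
    [m], which makes the increments of the partial products geometric. *)
Lemma normc_qpoch_part_le (a p : R[i]) m : normc p < 1 ->
  normc (qpoch_part a p m) <= expR (normc a / (1 - normc p)).
Proof.
move=> p1; have p0 := normc_ge0 p; have a0 := normc_ge0 a.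
apply: (@le_trans _ _ (expR (normc a * \sum_(0 <= j < m) normc p ^+ j))).
  rewrite /qpoch_part mulr_sumr expR_sum.
  elim: m => [|m IHm]; first by rewrite !big_geq// normc1.
  rewrite !big_nat_recr// normcM ler_pM ?normc_ge0//.
  apply: le_trans (le_normcD _ _) _.
  by rewrite normc1 normcN normcM normcX expR_ge1Dx.
by rewrite ler_expR ler_wpM2l// geometric_sum_le// p0.
Qed.

Lemma cvg_qpoch_part (a p : R[i]) : normc p < 1 ->
  cvgn (fun m => qpoch_part a p m : (R[i])^o).
Proof.
move=> p1; set B := expR (normc a / (1 - normc p)).
have incr m : normc (qpoch_part a p m.+1 - qpoch_part a p m) <=
    (B * normc a) * normc p ^+ m.
  have -> : qpoch_part a p m.+1 - qpoch_part a p m =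
      - (qpoch_part a p m * (a * p ^+ m)).
    by rewrite /qpoch_part big_nat_recr//=; ring.
  rewrite normcN !normcM normcX mulrA ler_wpM2r ?exprn_ge0 ?normc_ge0//.
  by rewrite ler_wpM2r ?normc_ge0// normc_qpoch_part_le.
have p01 : 0 <= normc p < 1 by rewrite normc_ge0.
have cRe : cvgn (fun m => complex.Re (qpoch_part a p m)).
  apply: (cvg_geometric_increments p01) => m.
  apply: le_trans (incr m).
  have := Re_le_normc (qpoch_part a p m.+1 - qpoch_part a p m).
  by case: (qpoch_part a p m.+1) => ? ?; case: (qpoch_part a p m).
have cIm : cvgn (fun m => complex.Im (qpoch_part a p m)).
  apply: (cvg_geometric_increments p01) => m.
  apply: le_trans (incr m).
  have := Im_le_normc (qpoch_part a p m.+1 - qpoch_part a p m).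
  by case: (qpoch_part a p m.+1) => ? ?; case: (qpoch_part a p m).
rewrite (_ : (fun m => _) = fun m => complex.Re (qpoch_part a p m)
    +i* complex.Im (qpoch_part a p m) : (R[i])^o); last first.
  by apply/funext => m; case: (qpoch_part a p m).
apply/cvg_ex; eexists; exact: cvg_complex cRe cIm.
Qed.

(** Weierstrass's product inequality. In the induction [1 - \sum] may be negative, so it is the new
    factor [1 - normc (x n)] that has to be nonnegative. *)
Lemma normc_prod_ge (x : nat -> R[i]) n :
  (forall j, normc (x j) <= 1) ->
  1 - \sum_(0 <= j < n) normc (x j) <= normc (\prod_(0 <= j < n) (1 - x j)).
Proof.
move=> x1; elim: n => [|n IHn]; first by rewrite !big_geq// subr0 normc1.
rewrite !big_nat_recr// normcM.
have h : 1 - normc (x n) <= normc (1 - x n).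
  rewrite lerBlDr -{1}(@normc1 R) -{1}[1](subrK (x n)).
  exact: le_normcD.
have h0 : 0 <= 1 - normc (x n) by rewrite subr_ge0.
apply: (@le_trans _ _ (normc (\prod_(0 <= i < n) (1 - x i)) * (1 - normc (x
  n)))); last first.
  by rewrite ler_wpM2l ?normc_ge0.
apply: (@le_trans _ _ ((1 - \sum_(0 <= i < n) normc (x i)) * (1 - normc (x
  n)))); last first.
  by rewrite ler_wpM2r.
have s0 : 0 <= \sum_(0 <= i < n) normc (x i).
  by apply: sumr_ge0 => i _; exact: normc_ge0.
have := mulr_ge0 s0 (normc_ge0 (x n)).
by rewrite /=; lra.
Qed.

(* A tail of the product is bounded below by 1 - |a| sum_(j >= m) |p|^j. *)
Lemma qpoch_neq0 (a p : R[i]) : normc a < 1 -> normc p < 1 -> qpoch a p != 0.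
Proof.
move=> a1 p1; have p01 : 0 <= normc p < 1 by rewrite normc_ge0.
have cpm : geometric 1 (normc p) @ \oo --> (0 : R).
  by apply: cvg_geometric; rewrite ger0_norm ?normc_ge0.
(* With |p|^m below this value, the sum |a| |p|^m / (1 - |p|) that controls the tail is at most
   1/2. *)
have e0 : 0 < (1 - normc p) / 2 by rewrite divr_gt0// subr_gt0.
move/cvgrPdist_lt : cpm => /(_ _ e0)[m _ /(_ m (leqnn _))] /=.
rewrite sub0r normrN mul1r ger0_norm ?exprn_ge0 ?normc_ge0// => pm.
have apj j : normc (a * p ^+ j) < 1.
  rewrite normcM normcX; apply: le_lt_trans a1.
  by rewrite ler_piMr ?normc_ge0// exprn_ile1// ?normc_ge0// ltW.
have nz : qpoch_part a p m != 0.
  rewrite /qpoch_part prodf_seq_neq0; apply/allP => j _ /=.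
  rewrite subr_eq0; apply/eqP => aj; have := apj j.
  by rewrite -aj normc1 ltxx.
have cv := @cvg_qpoch_part (a * p ^+ m) p p1.
have tail n : 1 / 2 <= normc (qpoch_part (a * p ^+ m) p n).
  apply: le_trans (@normc_prod_ge (fun j => a * p ^+ m * p ^+ j) n _);
    last first.
    by move=> j; rewrite -mulrA -exprD ltW.
  have -> : \sum_(0 <= j < n) normc (a * p ^+ m * p ^+ j) =
      normc a * normc p ^+ m * \sum_(0 <= j < n) normc p ^+ j.
    by rewrite mulr_sumr; apply: eq_bigr => j _; rewrite !normcM !normcX.
  have := geometric_sum_le n p01.
  set S := \sum_(_ <= _ < _) _ => hS.
  have S0 : 0 <= S by apply: sumr_ge0 => i _; rewrite exprn_ge0 ?normc_ge0.
  have : normc a * normc p ^+ m * S <= ((1 - normc p) / 2) * (1 - normc p)^-1.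
    apply: ler_pM => //; first by rewrite mulr_ge0 ?exprn_ge0 ?normc_ge0.
    apply: le_trans (ltW pm); apply: ler_piMl; last exact: ltW.
    by rewrite exprn_ge0 ?normc_ge0.
  rewrite [X in _ <= X]mulrAC divff ?gt_eqF ?subr_gt0// => ?; lra.
have -> : qpoch a p = qpoch_part a p m * qpoch (a * p ^+ m) p.
  exact: (@lim_prod_tail R[i] _ _ _ cv).
rewrite mulf_neq0//; apply: (@lim_neq0 R[i] _ (1 / 2)%:C _ _ cv).
  by rewrite ltcR; lra.
by move=> n; rewrite norm_normc lecR.
Qed.

End complex_limits.

Section field_identities.

(** Both sides are (n - 1)/2. The right one is kept as [n - 1] copies of [1 - 1 / 2] because this is
    the exponent of 1 - q in [qGamma tau (1 / 2) ^+ (n - 1)]. *)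
Lemma sum_complement_fractions (K : numFieldType) n : (0 < n)%N ->
  \sum_(1 <= k < n) (1 - k%:R / n%:R) = (1 - 1 / 2) *+ (n - 1) :> K.
Proof.
case: n => // n _; have n0 : n.+1%:R != 0 :> K by rewrite pnatr_eq0.
(* The denominator stays fixed while the induction runs on the upper bound [m] alone. *)
suff H m : \sum_(1 <= k < m.+1) (1 - k%:R / n.+1%:R) =
    m%:R - m%:R * m.+1%:R / (2 * n.+1%:R) :> K.
  by rewrite H subn1 /= -[RHS]mulr_natr; field.
elim: m => [|m IHm]; first by rewrite big_geq// mul0r mul0r subrr.
rewrite big_nat_recr//= IHm -[m.+2]addn1 -[m.+1]addn1 !natrD.
by field.
Qed.

(** Here [A] stands for (q; q)_oo, [X] for (q^(1/2); q)_oo, [P] for the product of the (q^(k/n);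
    q)_oo and [c] for (1 - q)^(1/2); thus [X * A] is f(-q^(1/2)) and [P * A] is f(-q^(1/n)). *)
Lemma gauss_quotientE (F : fieldType) (A X P c : F) n :
  (0 < n)%N -> A != 0 -> X != 0 -> P != 0 ->
  A ^+ (n - 1) / P * c ^+ (n - 1) =
  (A / X * c) ^+ (n - 1) * ((X * A) ^+ (n - 1) / (A ^ (n%:Z - 2) * (P * A))).
Proof.
case: n => // n _ A0 X0 P0.
(* Now [n] is the predecessor. Splitting off one inverse leaves a natural exponent, and also covers
   the value -1 at [n = 0]. *)
have -> : A ^ (n.+1%:Z - 2) = A ^+ n / A.
  by rewrite (_ : n.+1%:Z - 2 = n%:Z + (-1)) ?expfzDr// intS; ring.
rewrite subn1 /= !exprMn !exprVn.
have An0 : A ^+ n != 0 by rewrite expf_neq0.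
have Xn0 : X ^+ n != 0 by rewrite expf_neq0.
by field; rewrite A0 An0 Xn0 P0.
Qed.

End field_identities.

(** * The product formula for every tau in the upper half-plane *)

Section product_formula.
Variables (R : realType) (tau : R[i]).
Hypothesis tau0 : 0 < complex.Im tau.

Let q := qpow tau 1.

Lemma normc_qpow_nat_lt1 n k : (0 < n)%N -> (0 < k)%N ->
  normc (qpow tau (k%:R / n%:R)) < 1.
Proof.
move=> n0 k0; rewrite (_ : k%:R / n%:R = (k%:R / n%:R : R)%:C); last first.
  by rewrite rmorphM fmorphV !rmorph_nat.
by apply: normc_qpow_lt1 => //; rewrite divr_gt0// ltr0n.
Qed.

Lemma qpow_natE n k : qpow tau (k%:R / n%:R) = qpow tau (1 / n%:R) ^+ k.
Proof. by rewrite -qpowMn -mulrnAl. Qed.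

Lemma qpow_nat_nn n : (0 < n)%N -> qpow tau (1 / n%:R) ^+ n = q.
Proof. by move=> n0; rewrite -qpow_natE divff// pnatr_eq0 -lt0n. Qed.

Lemma normc_q_lt1 : normc q < 1.
Proof.
by have := @normc_qpow_nat_lt1 1 1 isT isT; rewrite divr1.
Qed.

Lemma qpoch_qpow_neq0 n k : (0 < n)%N -> (0 < k)%N ->
  qpoch (qpow tau (k%:R / n%:R)) q != 0.
Proof.
by move=> n0 k0; apply: qpoch_neq0; [exact: normc_qpow_nat_lt1|exact:
  normc_q_lt1].
Qed.

Lemma ramanujan_f_dissect n : (0 < n)%N ->
  ramanujan_f (- qpow tau (1 / n%:R)) =
  (\prod_(1 <= k < n) qpoch (qpow tau (k%:R / n%:R)) q) * qpoch q q.
Proof.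
move=> n0; rewrite /ramanujan_f opprK; set s := qpow tau _.
have s1 : normc s < 1 by have := @normc_qpow_nat_lt1 n 1 n0 isT.
rewrite {1}/qpoch (@lim_prod_dissect R[i] s s n n0); last first.
  move=> b k k0; apply: (@cvg_qpoch_part R b (s ^+ k)).
  by rewrite normcX exprn_ilt1// ?normc_ge0// -lt0n.
(* The products start at [a = s], so class [k] carries the base [s ^+ k.+1]; the last class is (q;
   q)_oo and is split off below. *)
transitivity (\prod_(0 <= k < n) qpoch (s ^+ k.+1) q).
  by apply: eq_bigr => k _; rewrite -exprS /s qpow_nat_nn.
have sn : s ^+ n = q by exact: qpow_nat_nn.
case: n n0 @s {s1} sn => // n n0 s sn.
rewrite big_nat_recr//= sn big_add1 /=; congr (_ * _).
by apply: eq_bigr => k _; rewrite qpow_natE.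
Qed.

(** All factors share the same value [clog a], so the exponents add and no question of branches
    arises. *)
Lemma prod_cpow (a : R[i]) n : (0 < n)%N ->
  \prod_(1 <= k < n) cpow a (1 - k%:R / n%:R) = cpow a (1 - 1 / 2) ^+ (n - 1).
Proof.
move=> n0; rewrite /cpow -cexp_sum -cexpMn -mulr_suml.
by rewrite (sum_complement_fractions _ n0) mulrnAl.
Qed.

Lemma qGamma_product n : (0 < n)%N ->
  \prod_(1 <= k < n) qGamma tau (k%:R / n%:R) = qGauss_rhs n tau.
Proof.
move=> n0; rewrite /qGauss_rhs (ramanujan_f_dissect n0).
have := @ramanujan_f_dissect 2 isT; rewrite big_nat1 => ->.
rewrite /qGamma -/q big_split/= prod_cpow// prodf_div prodr_const_nat.
have f1 : ramanujan_f (- q) = qpoch q q by rewrite /ramanujan_f opprK.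
have A0 : qpoch q q != 0.
  by have := @qpoch_qpow_neq0 1 1 isT isT; rewrite divr1.
have X0 : qpoch (qpow tau (1 / 2)) q != 0 by exact: (@qpoch_qpow_neq0 2 1).
have P0 : \prod_(1 <= k < n) qpoch (qpow tau (k%:R / n%:R)) q != 0.
  rewrite big_nat prodf_seq_neq0; apply/allP => k _; apply/implyP =>
    /andP[k1 _].
  exact: qpoch_qpow_neq0.
by rewrite f1; exact: gauss_quotientE.
Qed.

End product_formula.

(** * Euler's integral *)

Section gamma_integral.
Variable R : realType.
Local Notation mu := (@lebesgue_measure R).

(** Young's inequality with conjugate exponents 1/(1 - t) and 1/t, for u^(1 - t) and v^t. *)
Lemma weighted_AMGM (u v t : R) : 0 <= u -> 0 <= v -> 0 < t < 1 ->
  u `^ (1 - t) * v `^ t <= (1 - t) * u + t * v.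
Proof.
move=> u0 v0 /andP[t0 t1]; have s0 : 0 < 1 - t by rewrite subr_gt0.
have := @conjugate_powR R (u `^ (1 - t)) (v `^ t) (1 - t)^-1 t^-1.
rewrite !powR_ge0 !invr_gt0 s0 t0 !invrK subrK -!powRrM !divff ?gt_eqF//.
rewrite !powRr1// [_ * u]mulrC [_ * v]mulrC.
by apply.
Qed.

(** Monotone convergence along an exhaustion of the half-line. It transfers integration by parts and
    substitution from compact intervals, where the integrands are smooth, to the improper
    integral. *)
Lemma ge0_cvg_integral_itv0y (f : R -> R) (a b : R^nat) :
  measurable_fun setT f -> (forall t, 0 < t -> 0 <= f t) ->
  (forall n, 0 < a n) -> nonincreasing_seq a -> nondecreasing_seq b ->
  a @ \oo --> (0 : R) -> b @ \oo --> +oo ->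
  (\int[mu]_(t in `[a n, b n]) (f t)%:E @[n --> \oo] -->
   \int[mu]_(t in `]0%R, +oo[) (f t)%:E)%E.
Proof.
move=> mf f0 a0 nia ndb cva cvb.
have -> : `]0%R, +oo[%classic = \bigcup_n `[a n, b n]%classic.
  apply/seteqP; split=> [x /=|x [n _] /=]; rewrite !in_itv/= ?andbT => x0.
    have h1 : \forall n \near \oo, a n < x by exact: (cvgr_lt _ cva).
    have h2 : \forall n \near \oo, x <= b n by move/cvgryPge : cvb; exact.
    have [n _ /(_ n (leqnn _))[an bn]] := filterI h1 h2.
    by exists n => //=; rewrite in_itv/= bn (ltW an).
  by case/andP: x0 => ax _; rewrite (lt_le_trans _ ax).
apply: ge0_nondecreasing_set_cvg_integral => //.
- move=> m n mn; rewrite subsetEset; apply: subset_itv; rewrite bnd_simp.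
    exact: nia.
  exact: ndb.
- by move=> n; apply/measurable_EFinP; exact: measurable_funTS.
- move=> n x /=; rewrite in_itv/= => /andP[ax _]; rewrite lee_fin f0//.
  exact: lt_le_trans ax.
Qed.

(** * Functional equation, Wendel's inequality and the value at 1/2 *)

Definition gamma_integrand (x t : R) : R := t `^ (x - 1) * expR (- t).

(** Taken in the extended reals because [fine] sends an infinite integral to 0: identities and
    bounds are proved here first, and finiteness is deduced from them. *)
Definition eGamma (x : R) : \bar R :=
  (\int[mu]_(t in `]0%R, +oo[) (gamma_integrand x t)%:E)%E.

Lemma Euler_GammaE (x : R) : Euler_Gamma x = fine (eGamma x).
Proof. by []. Qed.

Lemma measurable_gamma_integrand x : measurable_fun setT (gamma_integrand x).
Proof.
apply: measurable_funM; first exact: measurable_powR.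
by apply: measurableT_comp => //; exact: measurableT_comp.
Qed.

Lemma gamma_integrand_ge0 x t : 0 <= gamma_integrand x t.
Proof. by rewrite mulr_ge0 ?powR_ge0 ?expR_ge0. Qed.

Lemma continuous_gamma_integrand x t : 0 < t ->
  {for t, continuous (gamma_integrand x)}.
Proof.
move=> t0; apply: continuousM.
  by apply: differentiable_continuous; apply/derivable1_diffP/derivable_powR;
    rewrite in_itv/= andbT.
by apply: continuous_comp; [exact: opp_continuous|exact: continuous_expR].
Qed.

Lemma within_itv_continuous (f : R -> R) (a b : R) :
  (forall t, a <= t <= b -> {for t, continuous f}) ->
  {within `[a, b], continuous f}.
Proof.
move=> cf; apply: continuous_in_subspaceT => t; rewrite inE/= in_itv/=.
exact: cf.
Qed.

Lemma is_derive_NexpRN (t : R) :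
  is_derive t 1 (fun t : R => - expR (- t)) (expR (- t)).
Proof.
have d := is_derive1_comp (is_derive_expR (- t)) (is_deriveN (is_derive_id t
  1)).
by have := is_deriveN d; rewrite mulrN1 opprK.
Qed.

Lemma continuous_expRN (t : R) : {for t, continuous (fun t : R => expR (- t))}.
Proof.
by apply: continuous_comp; [exact: opp_continuous|exact: continuous_expR].
Qed.

Lemma continuous_powRl (y t : R) : 0 < t -> {for t, continuous (@powR R ^~ y)}.
Proof.
move=> t0; apply: differentiable_continuous; apply/derivable1_diffP.
by apply: derivable_powR; rewrite in_itv/= andbT.
Qed.

Lemma derivable_oo_LRcontinuousW (f : R -> R) (a b : R) :
  (forall t, a <= t <= b -> derivable f t 1) -> a < b ->
  derivable_oo_LRcontinuous f a b.
Proof.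
move=> df ab.
have cf t : a <= t <= b -> {for t, continuous f}.
  by move=> /df d; apply: differentiable_continuous; apply/derivable1_diffP.
split.
- by move=> t; rewrite in_itv/= => /andP[at_ tb]; apply: df; rewrite !ltW.
- by apply: cvg_at_right_filter; apply: cf; rewrite lexx ltW.
- by apply: cvg_at_left_filter; apply: cf; rewrite lexx ltW.
Qed.

(** The factors are t^x and -exp(-t). The lower end is positive because t^x need not be
    differentiable at 0. *)
Lemma gamma_integral_by_parts (x a b : R) : 0 < x -> 0 < a -> a < b ->
  (\int[mu]_(t in `[a, b]) (gamma_integrand (x + 1) t)%:E =
   (a `^ x * expR (- a) - b `^ x * expR (- b))%:E +
   x%:E * \int[mu]_(t in `[a, b]) (gamma_integrand x t)%:E)%E.
Proof.
move=> x0 a0 ab.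
have pos t : a <= t <= b -> 0 < t by case/andP => + _; exact: lt_le_trans.
have oo t : t \in `]a, b[ -> 0 < t.
  by rewrite in_itv/= => /andP[+ _]; exact: lt_trans.
have := @integration_by_parts R (@powR R ^~ x) (fun t => - expR (- t))
  (fun t => x * t `^ (x - 1)) (fun t => expR (- t)) a b ab.
rewrite /gamma_integrand addrK => ->.
- congr (_%:E + _)%E; first by rewrite !mulrN opprK addrC.
  have -> : (x%:E * \int[mu]_(t in `[a, b]) (t `^ (x - 1) * expR (- t))%:E =
      \int[mu]_(t in `[a, b]) (x%:E * (t `^ (x - 1) * expR (- t))%:E))%E.
    rewrite ge0_integralZl//=; last 2 first.
    + by move=> t _; rewrite lee_fin; exact: gamma_integrand_ge0.
    + by rewrite lee_fin ltW.
    apply/measurable_EFinP; apply: measurable_funTS.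
    exact: measurable_gamma_integrand.
  rewrite -[RHS]oppeK -[in RHS]integral_ge0N; last first.
    move=> t _; rewrite -EFinM lee_fin mulr_ge0 ?(ltW x0)//.
    by rewrite mulr_ge0 ?powR_ge0 ?expR_ge0.
  by congr (- _)%E; apply: eq_integral => t _;
    rewrite -EFinM -EFinN mulrN mulrA.
- apply: within_itv_continuous => t /pos t0.
  by apply: continuousM; [exact: cst_continuous|exact: continuous_powRl].
- apply: derivable_oo_LRcontinuousW => // t /pos t0.
  by apply: derivable_powR; rewrite in_itv/= andbT.
- by move=> t /oo t0; rewrite powR_derive1// in_itv/= andbT.
- by apply: within_itv_continuous => t _; exact: continuous_expRN.
- by apply: derivable_oo_LRcontinuousW.
- by move=> t _; rewrite derive1E; have [_ ->] := is_derive_NexpRN t.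
Qed.

(** For t >= 1 and k the integer part of |x|, t^x <= t^(k+1) while exp t >= t^(k+2) / (k+2)!, which
    bounds the product by (k+2)! / t. *)
Lemma cvg_powR_expRN (x : R) : (t `^ x * expR (- t)) @[t --> +oo] --> (0 : R).
Proof.
pose k := Num.truncn `|x|.
apply: (@squeeze_cvgr _ _ _ _ (fun=> 0) (fun t => (k.+2)`!%:R / t));
  last 2 first.
- exact: cvg_cst.
- rewrite -[X in _ --> X](mulr0 (k.+2)`!%:R); apply: cvgM; first exact: cvg_cst.
  by apply/gtr0_cvgV0; [exact: nbhs_pinfty_gt|exact: cvg_id].
near=> t; have t1 : 1 <= t by near: t; exact: nbhs_pinfty_ge.
have t0 : 0 < t by exact: lt_le_trans t1.
rewrite mulr_ge0 ?powR_ge0 ?expR_ge0//= expRN ler_pdivrMr ?expR_gt0//.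
have h1 : t `^ x <= t ^+ k.+1.
  rewrite -powR_mulrn ?(ltW t0)//; apply: ler_powR => //.
  by apply: le_trans (ler_norm x) _; rewrite ltW// truncnS_gt.
have h2 := expR_ge1Dxn k.+1 (ltW t0).
have f0 : 0 < (k.+2)`!%:R :> R by rewrite ltr0n fact_gt0.
apply: (le_trans h1); rewrite mulrAC ler_pdivlMr// -exprSr.
have : t ^+ k.+2 / (k.+2)`!%:R <= expR t by apply: le_trans h2; rewrite lerDr.
by rewrite ler_pdivrMr// mulrC.
Unshelve. all: by end_near. Qed.

(* An exhaustion of ]0, +oo[ by compact intervals. *)
Let b_ (n : nat) : R := n.+2%:R.
Let a_ n : R := (b_ n)^-1.

Let b_gt1 n : 1 < b_ n. Proof. by rewrite ltr1n. Qed.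

Let a_gt0 n : 0 < a_ n. Proof. by rewrite invr_gt0 ltr0n. Qed.

Let a_lt_b n : a_ n < b_ n.
Proof. by apply: (@lt_trans _ _ 1) => //; rewrite invf_lt1// ltr0n. Qed.

Let nondecreasing_b : nondecreasing_seq b_.
Proof. by move=> m n mn; rewrite ler_nat !ltnS. Qed.

Let nonincreasing_a : nonincreasing_seq a_.
Proof. by move=> m n mn; rewrite lef_pV2 ?posrE ?ltr0n// nondecreasing_b. Qed.

Let cvg_b : b_ @ \oo --> +oo.
Proof.
apply/cvgryPge => A; near=> n; apply: (@le_trans _ _ n%:R).
  by near: n; exact: nbhs_infty_ger.
by rewrite ler_nat; lia.
Unshelve. all: by end_near. Qed.

Let cvg_a : a_ @ \oo --> (0 : R).
Proof.
apply/gtr0_cvgV0; last exact: cvg_b.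
by near=> n; rewrite ltr0n.
Unshelve. all: by end_near. Qed.

Lemma eGammaS (x : R) : 0 < x -> eGamma (x + 1) = (x%:E * eGamma x)%E.
Proof.
move=> x0.
have cv y := ge0_cvg_integral_itv0y (@measurable_gamma_integrand y)
  (fun t _ => @gamma_integrand_ge0 y t) a_gt0 nonincreasing_a nondecreasing_b
  cvg_a cvg_b.
apply: (cvg_unique (@ereal_hausdorff R) (cv (x + 1))).
rewrite (_ : (fun n => _) = fun n =>
    ((a_ n `^ x * expR (- a_ n) - b_ n `^ x * expR (- b_ n))%:E +
     x%:E * \int[mu]_(t in `[a_ n, b_ n]) (gamma_integrand x t)%:E)%E);
       last first.
  by apply/funext => n; rewrite gamma_integral_by_parts.
have <- : (0 + x%:E * eGamma x = x%:E * eGamma x)%E by rewrite add0e.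
apply: cvgeD.
- by rewrite fin_num_adde_defr.
- apply: cvg_EFin; first by near=> n.
  rewrite -(subr0 0); apply: cvgB.
    rewrite -(mul0r (expR (- 0))); apply: cvgM.
      by move/cvg_at_rightP : (powR_cvg0 x0) => /(_ a_); apply.
    by apply: (@cvg_comp _ _ _ a_ (fun t => expR (- t)) _ _ _ cvg_a);
      exact: continuous_expRN.
  by apply: (cvg_comp b_ (fun t => t `^ x * expR (- t)) cvg_b);
    exact: cvg_powR_expRN.
- by apply: cvgeZl => //; exact: cv.
Unshelve. all: by end_near. Qed.

Lemma eGamma1 : eGamma 1 = 1%E.
Proof.
transitivity (\int[mu]_(t in `[0%R, +oo[) (expR (- t))%:E)%E.
  rewrite -integral_itv_obnd_cbnd//; last first.
    apply/measurable_EFinP; apply: measurable_funTS;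
      apply: continuous_measurable_fun.
    by move=> t; exact: continuous_expRN.
  by apply: eq_integral => t _; rewrite /gamma_integrand subrr powRr0 mul1r.
rewrite (@ge0_continuous_FTC2y _ _ (fun t => - expR (- t)) _ 0).
- by rewrite oppr0 expR0 -EFinB sub0r opprK.
- by move=> t _; exact: expR_ge0.
- by apply: continuous_subspaceT => t; exact: continuous_expRN.
- by rewrite -oppr0; apply: cvgN; exact: cvgr_expR.
- by move=> t _; have [] := is_derive_NexpRN t.
- apply: cvg_at_right_filter; apply: cvgN; exact: continuous_expRN.
- by move=> t _; rewrite derive1E; have [_ ->] := is_derive_NexpRN t.
Qed.

Lemma eGamma_ge0 x : (0 <= eGamma x)%E.
Proof. by apply: integral_ge0 => t _; rewrite lee_fin gamma_integrand_ge0. Qed.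

(** This is [weighted_AMGM] for [y] and [s], multiplied by s^(y-1) exp(-s). The reference point [y]
    is chosen so that, after integration, Gamma(y + 1) = y Gamma(y) gives the two terms the weights
    1 - t and t. *)
Lemma gamma_integrandD_le (y t s : R) : 0 < y -> 0 < t < 1 -> 0 < s ->
  gamma_integrand (y + t) s <= y `^ t * (1 - t) * gamma_integrand y s +
    y `^ t * (t / y) * gamma_integrand (y + 1) s.
Proof.
move=> y0 t01 sp; rewrite /gamma_integrand addrK.
have -> : s `^ (y + t - 1) = s `^ t * s `^ (y - 1).
  rewrite (_ : y + t - 1 = t + (y - 1)); last by ring.
  by rewrite powRD ?(gt_eqF sp) ?implybT.
have -> : s `^ y = s * s `^ (y - 1) by rewrite mulr_powRB1// ltW.
rewrite [leRHS](_ : _ =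
  y `^ t * ((1 - t) + t / y * s) * (s `^ (y - 1) * expR (- s))); last by ring.
rewrite -mulrA ler_wpM2r ?mulr_ge0 ?powR_ge0 ?expR_ge0//.
have := @weighted_AMGM y s t (ltW y0) (ltW sp) t01.
have yt0 : 0 < y `^ t by rewrite powR_gt0.
have -> : y `^ (1 - t) = y / y `^ t.
  by rewrite powRB ?powRr1 ?(ltW y0)// (gt_eqF y0) implybT.
rewrite mulrAC ler_pdivrMr// => h.
rewrite -(ler_pM2l y0); apply: le_trans h _.
by rewrite le_eqVlt; apply/orP; left; apply/eqP; field; rewrite gt_eqF.
Qed.

(** Wendel's inequality, a form of log-convexity. As it holds in the extended reals, it also yields
    finiteness. *)
Lemma eGammaD_le (y t : R) : 0 < y -> 0 < t < 1 ->
  (eGamma (y + t) <= (y `^ t)%:E * eGamma y)%E.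
Proof.
move=> y0 t01; have /andP[t0 t1] := t01.
have c0 : 0 < y `^ t by rewrite powR_gt0.
have mg z : measurable_fun (`]0%R, +oo[%classic : set R) (EFin \o
  gamma_integrand z).
  apply/measurable_EFinP; apply: measurable_funTS.
  exact: measurable_gamma_integrand.
have g0 z (k s : R) : 0 <= k -> (0 <= (k * gamma_integrand z s)%:E)%E.
  by move=> k0; rewrite lee_fin mulr_ge0 ?gamma_integrand_ge0.
have Z k z : 0 <= k ->
    (\int[mu]_(s in `]0%R, +oo[) (k * gamma_integrand z s)%:E = k%:E * eGamma
      z)%E.
  move=> k0; rewrite /eGamma -ge0_integralZl//; first exact: mg.
  by move=> s _; rewrite lee_fin gamma_integrand_ge0.
have s0 : 0 <= 1 - t by rewrite subr_ge0 ltW.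
have ty0 : 0 <= t / y by rewrite divr_ge0 ?ltW.
have mZ k z : measurable_fun (`]0%R, +oo[%classic : set R)
    (fun s => (k * gamma_integrand z s)%:E).
  by apply/measurable_EFinP; apply: measurable_funM => //;
    exact/measurable_EFinP.
have -> : ((y `^ t)%:E * eGamma y =
    (y `^ t * (1 - t))%:E * eGamma y + (y `^ t * (t / y))%:E * eGamma (y +
      1))%E.
  rewrite eGammaS// muleA -EFinM -mulrA divfK ?gt_eqF//.
  rewrite -ge0_muleDl ?lee_fin ?mulr_ge0 ?(ltW c0) ?(ltW t0)//.
  by rewrite -EFinD -mulrDr subrK mulr1.
have k1 : 0 <= y `^ t * (1 - t) by rewrite mulr_ge0 ?(ltW c0).
have k2 : 0 <= y `^ t * (t / y) by rewrite mulr_ge0 ?(ltW c0).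
rewrite -(Z _ y k1) -(Z _ (y + 1) k2).
rewrite -ge0_integralD//; [|by move=> s _; exact: g0|exact: mZ
  |by move=> s _; exact: g0|exact: mZ].
apply: ge0_le_integral => //.
- by move=> s _; rewrite lee_fin gamma_integrand_ge0.
- exact: (mg (y + t)).
- by apply: emeasurable_funD; exact: mZ.
move=> s; rewrite /= in_itv/= andbT => sp.
by rewrite -EFinD lee_fin gamma_integrandD_le.
Qed.

(** The substitution t = s^2 turns the integrand into 2 exp(-s^2). It is made on compact intervals
    away from 0, which is why the exhaustion on the Gamma side has squared endpoints. *)
Lemma eGamma_half : eGamma (1 / 2) = (Num.sqrt pi)%:E.
Proof.
have a2_gt0 n : 0 < a_ n ^+ 2 by rewrite exprn_gt0.
have a2_ni : nonincreasing_seq (fun n => a_ n ^+ 2).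
  by move=> m n mn; rewrite lerXn2r ?nnegrE ?(ltW (a_gt0 _))// nonincreasing_a.
have b_ge0 n : 0 <= b_ n by exact: ler0n.
have b2_nd : nondecreasing_seq (fun n => b_ n ^+ 2).
  by move=> m n mn; rewrite lerXn2r ?nnegrE ?b_ge0// nondecreasing_b.
have a2_cvg : a_ n ^+ 2 @[n --> \oo] --> (0 : R).
  by rewrite -(mulr0 0); apply: cvgM; exact: cvg_a.
have b2_cvg : b_ n ^+ 2 @[n --> \oo] --> +oo.
  by apply: (cvg_comp b_ (fun x => x ^+ 2) cvg_b); exact: cvgr_expr2.
have cvl := ge0_cvg_integral_itv0y (@measurable_gamma_integrand (1 / 2))
  (fun t _ => @gamma_integrand_ge0 (1 / 2) t) a2_gt0 a2_ni b2_nd a2_cvg b2_cvg.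
have mg : measurable_fun setT (fun s : R => 2 * gauss_fun s).
  by apply: measurable_funM => //; exact: measurable_gauss_fun.
have g0 (s : R) : 0 < s -> 0 <= 2 * gauss_fun s.
  by move=> _; rewrite mulr_ge0 ?gauss_fun_ge0.
have cvr := ge0_cvg_integral_itv0y mg g0 a_gt0 nonincreasing_a nondecreasing_b
  cvg_a cvg_b.
have -> : (Num.sqrt pi)%:E =
    (\int[mu]_(s in `]0%R, +oo[) (2 * gauss_fun s)%:E)%E.
  rewrite integral_itv_obnd_cbnd; last first.
    by apply/measurable_EFinP; exact: measurable_funTS.
  under eq_integral do rewrite EFinM.
  rewrite ge0_integralZl//; last 2 first.
  - by apply/measurable_EFinP; apply: measurable_funTS;
    exact: measurable_gauss_fun.
  - by move=> s _; rewrite lee_fin gauss_fun_ge0.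
  by rewrite integral0y_gauss -EFinM mulrCA divff// mulr1.
apply: (cvg_unique (@ereal_hausdorff R) cvl).
rewrite (_ : (fun n => _) = fun n =>
  (\int[mu]_(s in `[a_ n, b_ n]) (2 * gauss_fun s)%:E)%E)//.
apply/funext => n.
have dFE : (fun s : R => s ^+ 2)^`()%classic = (fun t => 2 * t).
  by apply/funext => t; rewrite exp_derive1 expr1.
have cdF t : {for t, continuous (fun t : R => 2 * t)}.
  by apply: continuousM; [exact: cst_continuous|exact: cvg_id].
rewrite (@integration_by_substitution_increasing R (fun s => s ^+ 2)
  (gamma_integrand (1 / 2)) (a_ n) (b_ n) (ltW (a_lt_b n))) ?dFE.
- apply: eq_integral => s; rewrite inE/= in_itv/= => /andP[as_ _].
  have s0 : 0 < s by exact: lt_le_trans as_.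
  congr EFin; rewrite -[LHS]/(gamma_integrand (1 / 2) (s ^+ 2) * (2 * s)).
  rewrite /gamma_integrand /gauss_fun (_ : 1 / 2 - 1 = - 2^-1); last by field.
  rewrite powRN powR12_sqrt ?sqr_ge0// sqrtr_sqr gtr0_norm//.
  by field; rewrite gt_eqF.
- move=> x y; rewrite !in_itv/= => /andP[ax _] /andP[ay _] xy.
  by rewrite ltrXn2r// (le_trans _ ax)// ltW.
- by move=> t _; exact: cdF.
- by apply/cvg_ex; exists (2 * a_ n); apply: cvg_at_right_filter; exact: cdF.
- by apply/cvg_ex; exists (2 * b_ n); apply: cvg_at_left_filter; exact: cdF.
- by apply: derivable_oo_LRcontinuousW => // t _; exact: exprn_derivable.
- apply: within_itv_continuous => t /andP[at_ _].
  by apply: continuous_gamma_integrand; exact: lt_le_trans at_.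
Qed.

Lemma eGamma_fin_itv x N : 0 < x < 1 -> eGamma (x + N%:R) \is a fin_num.
Proof.
move=> x01; have /andP[x0 x1] := x01.
elim: N => [|N IHN]; last first.
  by rewrite -natr1 addrA eGammaS ?fin_numM// ltr_wpDr.
rewrite addr0 ge0_fin_numE ?eGamma_ge0//.
(* Wendel's inequality at 1 reads x Gamma(x) <= 1, so Gamma(x) cannot be infinite. *)
have := @eGammaD_le 1 x ltr01 x01; rewrite addrC eGammaS// eGamma1 powR1 mule1.
apply: contraTT; rewrite -leNgt leye_eq => /eqP ->.
by rewrite gt0_muley ?lte_fin// -ltNge ltry.
Qed.

Lemma eGamma_fin_nat N : eGamma N.+1%:R \is a fin_num.
Proof.
elim: N => [|N IHN]; first by rewrite eGamma1.
by rewrite -natr1 eGammaS ?fin_numM// ltr0n.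
Qed.

Lemma Euler_GammaS (x : R) : 0 < x -> Euler_Gamma (x + 1) = x * Euler_Gamma x.
Proof.
move=> x0; rewrite !Euler_GammaE eGammaS//.
case: (eGamma x) (eGamma_ge0 x) => [r| |]//= _.
by rewrite gt0_muley ?lte_fin//= mulr0.
Qed.

Lemma Euler_Gamma_nat N : Euler_Gamma N.+1%:R = N`!%:R :> R.
Proof.
elim: N => [|N IHN]; first by rewrite Euler_GammaE eGamma1.
by rewrite -natr1 Euler_GammaS ?ltr0n// IHN factS natrM.
Qed.

Lemma Euler_Gamma_half : Euler_Gamma (1 / 2) = Num.sqrt pi :> R.
Proof. by rewrite Euler_GammaE eGamma_half. Qed.

Lemma Euler_GammaD_le (y t : R) : 0 < y -> 0 < t < 1 ->
  eGamma y \is a fin_num -> Euler_Gamma (y + t) <= y `^ t * Euler_Gamma y.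
Proof.
move=> y0 t01 fy; rewrite -lee_fin EFinM !Euler_GammaE (fineK fy) fineK
  ?eGammaD_le//.
rewrite ge0_fin_numE ?eGamma_ge0//; apply: le_lt_trans (eGammaD_le y0 t01) _.
by rewrite -(fineK fy) -EFinM ltry.
Qed.

Lemma Euler_GammaDn (x : R) N : 0 < x ->
  Euler_Gamma (x + N%:R) = (\prod_(0 <= j < N) (x + j%:R)) * Euler_Gamma x.
Proof.
move=> x0; elim: N => [|N IHN]; first by rewrite addr0 big_geq// mul1r.
have xN0 : 0 < x + N%:R by rewrite ltr_wpDr.
have -> : x + N.+1%:R = x + N%:R + 1 by rewrite -addrA natr1.
rewrite (Euler_GammaS xN0) IHN mulrA [_ * \prod_(_ <= _ < _) _]mulrC.
by rewrite big_nat_recr.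
Qed.

(** Gauss's usual approximation has [N + 1] factors in the denominator and N^x above. With [N]
    factors, the denominator at x = k/n is exactly a residue class in [fact_dissect]. *)
Definition Gamma_approx (x : R) (N : nat) : R :=
  N`!%:R / (\prod_(0 <= j < N) (x + j%:R)) * N%:R `^ (x - 1).

(** Positivity lets the Pochhammer product be moved across the inequalities below. *)
Lemma prod_shift_gt0 (x : R) N : 0 < x -> 0 < \prod_(0 <= j < N) (x + j%:R).
Proof. by move=> x0; apply: prodr_gt0 => j _; rewrite ltr_wpDr. Qed.

Lemma Gamma_approx_ge (x : R) N : 0 < x < 1 ->
  Euler_Gamma x <= Gamma_approx x N.+1.
Proof.
(* Wendel's inequality is taken from N + 1 to N + 1 + x. *)
move=> x01; have /andP[x0 x1] := x01.
have := @Euler_GammaD_le N.+1%:R x _ x01 (eGamma_fin_nat N).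
rewrite ltr0n => /(_ isT).
rewrite addrC Euler_GammaDn// Euler_Gamma_nat.
rewrite -ler_pdivlMl ?prod_shift_gt0// => /le_trans; apply.
rewrite le_eqVlt; apply/orP; left; apply/eqP.
rewrite /Gamma_approx -[X in X * N`!%:R](@mulr_powRB1 _ N.+1%:R x)//.
by rewrite factS natrM; ring.
Qed.

(** Wendel's inequality from x + n to n + 1, with n = N + 1 and step 1 - x; the error factor is (1 +
    x/n)^(1-x) <= 1 + 1/n. *)
Lemma Gamma_approx_le (x : R) N : 0 < x < 1 ->
  Gamma_approx x N.+1 <= Euler_Gamma x * (1 + N.+1%:R^-1).
Proof.
move=> x01; have /andP[x0 x1] := x01.
set n : R := N.+1%:R; have n0 : 0 < n by rewrite ltr0n.
have xn0 : 0 < x + n by rewrite addr_gt0.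
have t01 : 0 < 1 - x < 1 by rewrite subr_gt0 x1 ltrBlDr ltrDl.
have P0 := @prod_shift_gt0 x N.+1 x0.
have := Euler_GammaD_le xn0 t01 (eGamma_fin_itv _ x01).
rewrite (_ : x + n + (1 - x) = N.+2%:R); last by rewrite -[N.+2%:R]natr1; ring.
rewrite Euler_Gamma_nat Euler_GammaDn// => h.
rewrite /Gamma_approx mulrAC ler_pdivrMr//.
have -> : n `^ (x - 1) = (n `^ (1 - x))^-1 by rewrite -powRN opprB.
rewrite ler_pdivrMr ?powR_gt0//; apply: le_trans h _.
have G0 : 0 <= Euler_Gamma x by rewrite Euler_GammaE fine_ge0// eGamma_ge0.
rewrite [leRHS](_ : _ = (1 + n^-1) * n `^ (1 - x) *
  ((\prod_(0 <= j < N.+1) (x + j%:R)) * Euler_Gamma x)); last by ring.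
rewrite ler_wpM2r ?mulr_ge0 ?(ltW P0)//.
have -> : x + n = (1 + x / n) * n by rewrite mulrDl mul1r divfK ?gt_eqF// addrC.
have xn1 : 0 <= x / n by rewrite divr_ge0 ?ltW.
rewrite powRM ?addr_ge0 ?(ltW n0)// ler_wpM2r ?powR_ge0//.
apply: (@le_trans _ _ (1 + x / n)).
  by apply: ler1_powR; rewrite ?lerDl// lerBlDr lerDl ltW.
by rewrite lerD2l ler_pdivrMr// mulVf ?gt_eqF// ltW.
Qed.

Lemma cvg_Gamma_approx (x : R) : 0 < x < 1 ->
  Gamma_approx x N @[N --> \oo] --> Euler_Gamma x.
Proof.
move=> x01; rewrite -cvg_shiftS.
apply: (@squeeze_cvgr _ _ _ _ (fun=> Euler_Gamma x)
  (fun N => Euler_Gamma x * (1 + N.+1%:R^-1))).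
- by apply: nearW => N; rewrite Gamma_approx_ge// Gamma_approx_le.
- exact: cvg_cst.
- rewrite -[X in _ --> X]mulr1; apply: cvgM; first exact: cvg_cst.
  rewrite -[X in _ --> X]addr0; apply: cvgD; first exact: cvg_cst.
  exact: cvg_harmonic.
Qed.

End gamma_integral.

(** * Stirling's formula and Gauss's product *)

Section stirling.
Variable R : realType.

Lemma le_of_derive_ge0_ge1 (f df : R -> R) (y : R) : 1 <= y ->
  (forall x : R, 1 <= x -> is_derive x 1 f (df x)) ->
  (forall x, 1 <= x -> 0 <= df x) -> f 1 <= f y.
Proof.
move=> y1 fdf df0; rewrite -subr_ge0.
have [|||c] := @MVT_segment R f df 1 y => //.
- by move=> x; rewrite in_itv/= => /andP[/ltW + _]; exact: fdf.
- apply: within_itv_continuous => x /andP[x1 _].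
  apply: differentiable_continuous; apply/derivable1_diffP.
  by have [] := fdf x x1.
by rewrite in_itv/= => /andP[c1 _] ->; rewrite mulr_ge0 ?df0// subr_ge0.
Qed.

(** At y = (N + 1)/N the bound equals 1/(N + 1/2), which is just what makes [stirling_ratio]
    nonincreasing. The difference of the two sides has derivative (x - 1)^2 / (x (x + 1)^2). *)
Lemma ln_ge_rational (y : R) : 1 <= y -> 2 * (y - 1) / (y + 1) <= ln y.
Proof.
move=> y1.
have := @le_of_derive_ge0_ge1 (fun x => ln x + 4 * (x + 1)^-1)
  (fun x => x^-1 + 4 * (- (x + 1) ^- 2)) y y1.
rewrite ln1 (_ : 0 + 4 * (1 + 1)^-1 = 2); last by field.
move=> h; suff : 2 <= ln y + 4 * (y + 1)^-1.
  rewrite (_ : 2 * (y - 1) / (y + 1) = 2 - 4 * (y + 1)^-1); last by field; lra.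
  by move: (ln y) ((y + 1)^-1) => *; lra.
apply: h => x x1.
- apply: is_deriveD; first by apply: is_derive1_ln; lra.
  have x10 : x + 1 != 0 by lra.
  have d1 : is_derive x 1 (fun x : R => x + 1) 1.
    by apply: is_derive_eq; rewrite addr0.
  have := is_deriveZ 4 (@is_deriveV R (fun x => x + 1) x _ _ x10 d1).
  by rewrite [_ *: (1 : R)]mulr1.
- have x0 : 0 < x by lra.
  have x10 : 0 < x + 1 by lra.
  rewrite (_ : _ + _ = (x - 1) ^+ 2 / (x * (x + 1) ^+ 2)).
    by rewrite divr_ge0 ?sqr_ge0// mulr_ge0 ?sqr_ge0// ltW.
  by field; rewrite !gt_eqF.
Qed.

(** At y = (N + 1)/N, multiplied by N + 1/2, the bound is 1 + (1/N - 1/(N + 1))/4, whose excess over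
    1 telescopes. The difference of the two sides has derivative (1 - 1/x)^2 / 2. *)
Lemma ln_le_rational (y : R) : 1 <= y -> ln y <= (y - y^-1) / 2.
Proof.
move=> y1.
have := @le_of_derive_ge0_ge1 (fun x => 2^-1 * (x - x^-1) - ln x)
  (fun x => 2^-1 * (1 + x ^- 2) - x^-1) y y1.
rewrite ln1 invr1 subrr mulr0 subr0 => h.
suff : 0 <= 2^-1 * (y - y^-1) - ln y by lra.
apply: h => x x1.
- apply: is_deriveB; last by apply: is_derive1_ln; lra.
  have x0 : x != 0 by lra.
  apply: is_deriveZ.
  have := is_deriveB (is_derive_id x (1 : R)) (@is_deriveV R id x _ _ x0
    (is_derive_id x (1 : R))).
  by rewrite [_ *: (1 : R)]mulr1 opprK.
- have x0 : 0 < x by lra.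
  rewrite (_ : _ - _ = 2^-1 * (1 - x^-1) ^+ 2).
    by rewrite mulr_ge0 ?sqr_ge0// invr_ge0.
  by field; rewrite !gt_eqF.
Qed.

Definition stirling_ratio (N : nat) : R :=
  N`!%:R * expR N%:R / (N%:R ^+ N * Num.sqrt N%:R).

Lemma stirling_ratio_gt0 N : (0 < N)%N -> 0 < stirling_ratio N.
Proof.
move=> N0; have Np : 0 < N%:R :> R by rewrite ltr0n.
by rewrite divr_gt0 ?mulr_gt0 ?expR_gt0 ?exprn_gt0 ?sqrtr_gt0// ltr0n fact_gt0.
Qed.

Lemma ln_stirling_ratio N : (0 < N)%N -> ln (stirling_ratio N) =
  ln (N`!%:R) + N%:R - (N%:R + 1 / 2) * ln N%:R.
Proof.
move=> N0; have Np : 0 < N%:R :> R by rewrite ltr0n.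
have f0 : 0 < N`!%:R :> R by rewrite ltr0n fact_gt0.
rewrite /stirling_ratio ln_div ?posrE ?mulr_gt0 ?expR_gt0 ?exprn_gt0
  ?sqrtr_gt0//.
rewrite !lnM ?posrE ?expR_gt0 ?exprn_gt0 ?sqrtr_gt0// expRK lnXn//.
rewrite -powR12_sqrt ?(ltW Np)// ln_powR -mulr_natl; congr (_ - _).
by field.
Qed.

Lemma ln_stirling_ratio_step N : (0 < N)%N ->
  ln (stirling_ratio N) - ln (stirling_ratio N.+1) =
  (N%:R + 1 / 2) * ln (N.+1%:R / N%:R) - 1.
Proof.
move=> N0; have Np : 0 < N%:R :> R by rewrite ltr0n.
have N1p : 0 < N.+1%:R :> R by rewrite ltr0n.
rewrite !ln_stirling_ratio// factS natrM lnM ?posrE ?ltr0n ?fact_gt0//.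
rewrite ln_div ?posrE// -natr1; ring.
Qed.

Lemma ln_stirling_ratio_bounds N : (0 < N)%N ->
  0 <= ln (stirling_ratio N) - ln (stirling_ratio N.+1) <=
  1 / 4 * (N%:R^-1 - N.+1%:R^-1).
Proof.
move=> N0; have Np : 0 < N%:R :> R by rewrite ltr0n.
rewrite ln_stirling_ratio_step// -[N.+1%:R]natr1.
set x : R := N%:R in Np *; have x1 : 0 < x + 1 by lra.
have y1 : 1 <= (x + 1) / x by rewrite ler_pdivlMr// mul1r lerDl.
have x12 : 0 < x + 1 / 2 by lra.
apply/andP; split.
  rewrite subr_ge0; apply: le_trans (ler_wpM2l (ltW x12) (ln_ge_rational y1)).
  rewrite le_eqVlt; apply/orP; left; apply/eqP; field.
  by rewrite !gt_eqF//; lra.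
rewrite lerBlDr; apply: le_trans (ler_wpM2l (ltW x12) (ln_le_rational y1)) _.
rewrite le_eqVlt; apply/orP; left; apply/eqP; field.
by rewrite !gt_eqF//.
Qed.

(** The logarithms decrease, by a total of at most 1/4 after telescoping, so they converge; the
    limit of the ratios is an exponential, hence positive. *)
Lemma cvg_stirling_ratio : exists2 C : R, 0 < C & stirling_ratio @ \oo --> C.
Proof.
(* The index starts at 1, since [stirling_ratio 0] has denominator 0. *)
pose u n := ln (stirling_ratio n.+1).
have niu : nonincreasing_seq u.
  apply/nonincreasing_seqP => n.
  by have /andP[+ _] := @ln_stirling_ratio_bounds n.+1 isT; rewrite subr_ge0.
have lbu n : u 0 - 1 / 4 * (1 - n.+1%:R^-1) <= u n.
  elim: n => [|n IHn]; first by rewrite invr1 subrr mulr0 subr0.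
  have /andP[_] := @ln_stirling_ratio_bounds n.+1 isT.
  rewrite -/(u n) -/(u n.+1); move: IHn.
  by move: (n.+1%:R^-1) (n.+2%:R^-1) (u 0) (u n) (u n.+1) => *; lra.
have cu : cvgn u.
  apply: nonincreasing_is_cvgn => //; exists (u 0 - 1 / 4) => _ [n _ <-].
  apply: le_trans (lbu n); have : 0 <= n.+1%:R^-1 :> R by rewrite invr_ge0.
  by move: (n.+1%:R^-1) (u 0) => *; lra.
exists (expR (limn u)); first exact: expR_gt0.
rewrite -cvg_shiftS.
rewrite (_ : (fun n => _) = expR \o u); last first.
  by apply/funext => n /=; rewrite /u lnK// posrE stirling_ratio_gt0.
by apply: continuous_cvg cu; exact: continuous_expR.
Qed.

(** * Gauss's product from factorials *)

Lemma natr_fact m : m`!%:R = \prod_(0 <= i < m) i.+1%:R :> R.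
Proof.
elim: m => [|m IHm]; first by rewrite big_geq// fact0.
by rewrite factS mulnC natrM IHm big_nat_recr.
Qed.

(** The factor with index k + n j is k + 1 + n j = n ((k + 1)/n + j); the class k + 1 = n
    contributes N!. *)
Lemma fact_dissect n N : (0 < n)%N ->
  (n * N)`!%:R = n%:R ^+ (n * N) * N`!%:R *
    \prod_(1 <= k < n) \prod_(0 <= j < N) (k%:R / n%:R + j%:R) :> R.
Proof.
case: n => // n _; have n0 : n.+1%:R != 0 :> R by rewrite pnatr_eq0.
rewrite natr_fact (prod_dissect (fun i => i.+1%:R)).
transitivity (\prod_(0 <= k < n.+1) \prod_(0 <= j < N)
    (n.+1%:R * (k.+1%:R / n.+1%:R + j%:R)) : R).
  apply: eq_bigr => k _; apply: eq_bigr => j _.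
  by rewrite -addSn natrD natrM mulrDr mulrCA divff// mulr1.
under eq_bigr do rewrite big_split/= prodr_const_nat subn0.
rewrite big_split/= prodr_const_nat subn0 -exprM mulnC -mulrA; congr (_ * _).
rewrite big_nat_recr//= mulrC big_add1/= divff//; congr (_ * _).
by rewrite natr_fact; apply: eq_bigr => j _; rewrite -natr1 addrC.
Qed.

(** An exact identity: the exponents k/n - 1 add up to -(n - 1)/2, and the powers of e and of N^N
    cancel between the two Stirling ratios. *)
Lemma prod_Gamma_approx n N : (0 < n)%N -> (0 < N)%N ->
  \prod_(1 <= k < n) Gamma_approx (k%:R / n%:R : R) N =
  stirling_ratio N ^+ n / (stirling_ratio (n * N) * Num.sqrt n%:R).
Proof.
move=> n0 N0; have Np : 0 < N%:R :> R by rewrite ltr0n.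
have np : 0 < n%:R :> R by rewrite ltr0n.
have fNp : 0 < N`!%:R :> R by rewrite ltr0n fact_gt0.
rewrite /Gamma_approx big_split/= prodf_div prodr_const_nat.
have -> : \prod_(1 <= k < n) N%:R `^ (k%:R / n%:R - 1) =
    (Num.sqrt N%:R ^+ (n - 1))^-1 :> R.
  rewrite -powR12_sqrt ?(ltW Np)// -powR_mulrn ?powR_ge0// -powRrM -powRN.
  rewrite -(big_morph _ (fun x y => _ : N%:R `^ (x + y) = _) (powRr0 _));
    last first.
    by move=> x y; rewrite powRD// (gt_eqF Np) implybT.
  congr (_ `^ _); apply/eqP; rewrite -eqr_opp opprK -sumrN.
  under eq_bigr do rewrite opprB.
  by rewrite (sum_complement_fractions _ n0) -mulr_natr; apply/eqP; field.
have P0 : 0 < \prod_(1 <= k < n) \prod_(0 <= j < N) (k%:R / n%:R + j%:R) :> R.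
  rewrite big_nat; apply: prodr_gt0 => k /andP[k1 _].
  by apply: prod_shift_gt0; rewrite divr_gt0// ltr0n.
rewrite /stirling_ratio (fact_dissect N n0) natrM [in expR (n%:R *
  _)]expRM_natl.
rewrite [(n%:R * N%:R) ^+ _]exprMn sqrtrM ?(ltW np)//.
move: P0; set P := \prod_(_ <= _ < _) _ => P0.
have := sqrtr_gt0 (N%:R : R); rewrite Np; set s := Num.sqrt N%:R => s0.
have := sqrtr_gt0 (n%:R : R); rewrite np; set t := Num.sqrt n%:R => t0.
have e0 := expR_gt0 (N%:R : R); move: e0; set e := expR _ => e0.
have -> : N%:R ^+ (n * N) = (N%:R ^+ N) ^+ n :> R by rewrite -exprM mulnC.
rewrite !expr_div_n !exprMn.
case: n n0 {np} @P P0 @t t0 => // n n0 P P0 t t0; rewrite subn1 /= !exprS.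
have X0 : n.+1%:R ^+ (n.+1 * N) != 0 :> R by rewrite expf_neq0// pnatr_eq0.
have Y0 : (N%:R ^+ N) ^+ n != 0 :> R by rewrite !expf_neq0// gt_eqF.
have Z0 : N%:R ^+ N != 0 :> R by rewrite !expf_neq0// gt_eqF.
have sn0 : s ^+ n != 0 by rewrite expf_neq0// gt_eqF.
have en0 : e ^+ n != 0 by rewrite expf_neq0// gt_eqF.
have fn0 : N`!%:R ^+ n != 0 :> R by rewrite expf_neq0// gt_eqF.
move: X0 Y0 Z0 sn0 en0 fn0 (gt_eqF s0) (gt_eqF t0) (gt_eqF e0) (gt_eqF P0)
  (gt_eqF fNp).
(* Powers with variable exponents become opaque, which leaves [field] a plain rational identity. *)
move: (n.+1%:R ^+ _ : R) ((N%:R ^+ N) ^+ n : R) (N%:R ^+ N : R) (s ^+ n) (e ^+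
  n).
move: (N`!%:R ^+ n : R).
move=> fn X Y Z sn en X0 Y0 Z0 sn0 en0 fn0 s1 t1 e1 P1 f1.
by field; rewrite X0 Y0 Z0 sn0 en0 s1 t1 e1 P1 f1.
Qed.

Lemma prod_Euler_Gamma_stirling (C : R) n : (0 < n)%N -> 0 < C ->
  stirling_ratio @ \oo --> C ->
  \prod_(1 <= k < n) Euler_Gamma (k%:R / n%:R : R) = C ^+ (n - 1) / Num.sqrt
    n%:R.
Proof.
move=> n0 C0 cC; have np : 0 < n%:R :> R by rewrite ltr0n.
have cv1 : \prod_(1 <= k < n) Gamma_approx (k%:R / n%:R : R) N @[N --> \oo] -->
    \prod_(1 <= k < n) Euler_Gamma (k%:R / n%:R : R).
  rewrite big_nat; under eq_fun do rewrite big_nat.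
  apply: cvg_big_prod => k /andP[k1 kn]; apply: cvg_Gamma_approx.
  by rewrite divr_gt0 ?ltr0n//= ltr_pdivrMr// mul1r ltr_nat.
have cv2 : stirling_ratio N ^+ n / (stirling_ratio (n * N) * Num.sqrt n%:R)
    @[N --> \oo] --> C ^+ n / (C * Num.sqrt n%:R).
  apply: cvgM; first by apply: (continuous_cvg _ (@exprn_continuous _ n C)).
  apply: cvgV; first by rewrite mulf_neq0// ?gt_eqF// sqrtr_gt0.
  apply: cvgM; last exact: cvg_cst.
  by apply: (cvg_comp (muln n) stirling_ratio); [exact: cvg_mulnl|exact: cC].
have cv3 : \prod_(1 <= k < n) Gamma_approx (k%:R / n%:R : R) N @[N --> \oo] -->
    C ^+ n / (C * Num.sqrt n%:R).
  apply: cvg_trans cv2; apply: near_eq_cvg; near=> N.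
  by rewrite prod_Gamma_approx//; near: N; exact: nbhs_infty_gt.
rewrite (cvg_unique (@Rhausdorff R) cv1 cv3) -{1}(prednK n0) exprS subn1.
by rewrite -mulf_div divff ?gt_eqF// mul1r.
Unshelve. all: by end_near. Qed.

(* The constant in Stirling's formula is read off the case n = 2, since
   Gamma(1/2) is the Gaussian integral. *)
Lemma Gauss_product_Euler_Gamma n : (0 < n)%N ->
  \prod_(1 <= k < n) Euler_Gamma (k%:R / n%:R : R) = Gauss_value R n.
Proof.
move=> n0; have [C C0 cC] := cvg_stirling_ratio.
have := @prod_Euler_Gamma_stirling C 2 isT C0 cC.
rewrite big_nat1 Euler_Gamma_half expr1 => piE.
have s2 : 0 < Num.sqrt 2%:R :> R by rewrite sqrtr_gt0.
have CE : C = (2 * pi) `^ (1 / 2).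
  rewrite div1r powR12_sqrt ?mulr_ge0 ?pi_ge0// sqrtrM// piE mulrC divfK//.
rewrite (prod_Euler_Gamma_stirling n0 C0 cC) /Gauss_value CE; congr (_ / _).
rewrite -powR_mulrn ?powR_ge0// -powRrM natrB//; congr (_ `^ _).
by field.
Qed.

End stirling.

(** * Bounds on the q-gamma function *)

Section real_q.
Variable R : realType.

(** Two instances of [weighted_AMGM], for [u], [v] and for [1 - u], [1 - v], have right-hand sides
    adding up to 1. For powers of q this is the log-concavity of z |-> 1 - q^z. *)
Lemma geometric_mean_onem_le (u v t : R) : 0 <= u <= 1 -> 0 <= v <= 1 ->
  0 < t < 1 ->
  (1 - u) `^ (1 - t) * (1 - v) `^ t <= 1 - u `^ (1 - t) * v `^ t.
Proof.
move=> /andP[u0 u1] /andP[v0 v1] t01.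
have u1' : 0 <= 1 - u by lra.
have v1' : 0 <= 1 - v by lra.
have := weighted_AMGM u0 v0 t01; have := weighted_AMGM u1' v1' t01.
by move: (_ `^ _ * _) (_ `^ _ * _) => *; lra.
Qed.

Lemma powR_onemM (u t : R) : 0 < u -> u `^ (1 - t) * u `^ t = u.
Proof.
by move=> u0; rewrite -powRD ?(gt_eqF u0) ?implybT// subrK powRr1// ltW.
Qed.

Lemma powR_le1 (u t : R) : 0 <= u <= 1 -> 0 <= t -> u `^ t <= 1.
Proof.
move=> /andP[u0 u1] t0; have := ge0_ler_powR t0 => /(_ u 1).
by rewrite !nnegrE powR1; apply.
Qed.

Lemma powR_div (u v t : R) : 0 <= u -> 0 <= v -> (u / v) `^ t = u `^ t / v `^ t.
Proof.
move=> u0 v0; rewrite powRM ?invr_ge0//; congr (_ * _).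
by rewrite -[in LHS](powR_inv1 v0) powRAC powR_inv1 ?powR_ge0.
Qed.

Section tail.
Variables (q x : R).
Hypotheses (q01 : 0 < q < 1) (x01 : 0 < x < 1).

Let q0 : 0 < q. Proof. by case/andP: q01. Qed.
Let q1 : q < 1. Proof. by case/andP: q01. Qed.
Let x0 : 0 < x. Proof. by case/andP: x01. Qed.
Let x1 : x < 1. Proof. by case/andP: x01. Qed.
Let a := q `^ x.

Let a0 : 0 < a. Proof. exact: powR_gt0. Qed.

Let a1 : a < 1.
Proof.
have <- : (1 : R) `^ x = 1 by rewrite powR1.
by rewrite gt0_ltr_powR// ?nnegrE// ltW.
Qed.

Let qa : q <= a.
Proof. by apply: ger1_powR; [rewrite q0 ltW|exact: ltW]. Qed.

Let qj01 j : 0 <= q ^+ j <= 1.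
Proof. by rewrite exprn_ge0 ?exprn_ile1 ?(ltW q0) ?(ltW q1). Qed.

Let aqj01 j : 0 <= a * q ^+ j <= 1.
Proof.
have /andP[h0 h1] := qj01 j; rewrite mulr_ge0 ?(ltW a0)//=.
by rewrite mulr_ile1 ?(ltW a0) ?(ltW a1).
Qed.

Let aqj_gt0 j : 0 < 1 - a * q ^+ j.
Proof.
have /andP[h0 h1] := qj01 j; rewrite subr_gt0; apply: le_lt_trans a1.
by rewrite ler_piMr ?(ltW a0).
Qed.

Let qj_gt0 j : 0 < 1 - q ^+ j.+1.
Proof. by rewrite subr_gt0 exprn_ilt1 ?(ltW q0). Qed.

Let qj_ge0 j : 0 <= 1 - q ^+ j.
Proof. by rewrite subr_ge0; have /andP[] := qj01 j. Qed.

(** Log-concavity at j + x = (1 - x) j + x (j + 1). *)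
Lemma q_step_upper j :
  (1 - q ^+ j) `^ (1 - x) * (1 - q ^+ j.+1) `^ x <= 1 - a * q ^+ j.
Proof.
have := geometric_mean_onem_le (qj01 j) (qj01 j.+1) x01.
suff -> : (q ^+ j) `^ (1 - x) * (q ^+ j.+1) `^ x = a * q ^+ j by [].
rewrite exprS powRM ?exprn_ge0 ?(ltW q0)// mulrCA.
by rewrite (powR_onemM x (exprn_gt0 j q0)).
Qed.

(** Log-concavity at j + 1 = x (x + j) + (1 - x) (x + j + 1). *)
Lemma q_step_lower j :
  (1 - a * q ^+ j) `^ x * (1 - a * q ^+ j.+1) `^ (1 - x) <= 1 - q ^+ j.+1.
Proof.
have t01 : 0 < 1 - x < 1 by rewrite subr_gt0 x1 ltrBlDr ltrDl.
have := geometric_mean_onem_le (aqj01 j) (aqj01 j.+1) t01; rewrite subKr.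
suff -> : (a * q ^+ j) `^ x * (a * q ^+ j.+1) `^ (1 - x) = q ^+ j.+1 by [].
have y0 : 0 < a * q ^+ j by rewrite mulr_gt0 ?exprn_gt0.
rewrite exprSr mulrA (powRM _ (ltW y0) (ltW q0)) mulrA [_ `^ x * _]mulrC.
rewrite (powR_onemM x y0) mulrAC [a * _]mulrC (powR_onemM x q0).
by rewrite mulrC.
Qed.

Definition q_ratio j : R := (1 - q ^+ j.+1) / (1 - a * q ^+ j).

Lemma q_ratio_gt0 j : 0 < q_ratio j.
Proof. by rewrite divr_gt0. Qed.

(** By [q_step_upper], [q_ratio j] is at most ((1 - q^(j+1)) / (1 - q^j))^(1-x), which telescopes;
    the multiplied form avoids the zero denominator at j = 0. *)
Lemma q_tail_upper N M :
  \prod_(N <= j < N + M) q_ratio j * (1 - q ^+ N) `^ (1 - x) <=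
  (1 - q ^+ (N + M)) `^ (1 - x).
Proof.
elim: M => [|M IHM]; first by rewrite addn0 big_geq// mul1r.
rewrite addnS big_nat_recr ?leq_addr//= mulrAC.
apply: le_trans (ler_wpM2r (ltW (q_ratio_gt0 _)) IHM) _.
set j := (N + M)%N; rewrite /q_ratio mulrA ler_pdivrMr//.
rewrite -[X in _ * X <= _](powR_onemM x (qj_gt0 j)) mulrCA ler_pM2l ?powR_gt0//.
exact: q_step_upper.
Qed.

Lemma q_tail_lower N M :
  (1 - a * q ^+ (N + M)) `^ (1 - x) <=
  \prod_(N <= j < N + M) q_ratio j * (1 - a * q ^+ N) `^ (1 - x).
Proof.
elim: M => [|M IHM]; first by rewrite addn0 big_geq// mul1r.
rewrite addnS big_nat_recr ?leq_addr//= [leRHS]mulrAC.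
apply: le_trans (ler_wpM2r (ltW (q_ratio_gt0 _)) IHM).
set j := (N + M)%N; rewrite /q_ratio mulrA ler_pdivlMr//.
rewrite -[X in _ * X <= _](powR_onemM x (aqj_gt0 j)) mulrCA ler_pM2l ?powR_gt0//
  mulrC.
exact: q_step_lower.
Qed.

Definition qGamma_part (m : nat) : R :=
  \prod_(0 <= j < m) q_ratio j * (1 - q) `^ (1 - x).

(* The q-analogue of Gamma_approx. *)
Definition qGamma_approx (N : nat) : R :=
  qGamma_part N / (1 - q ^+ N) `^ (1 - x).

Let prod_ratio_gt0 N : 0 < \prod_(0 <= j < N) q_ratio j.
Proof. by apply: prodr_gt0 => j _; exact: q_ratio_gt0. Qed.

Let part_gt0 N : 0 < qGamma_part N.
Proof. by rewrite mulr_gt0// powR_gt0// subr_gt0. Qed.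

Let part_cat N M : qGamma_part (N + M) =
  qGamma_part N * \prod_(N <= j < N + M) q_ratio j.
Proof.
by rewrite /qGamma_part (big_cat_nat (n := N)) ?leq_addr//= mulrAC.
Qed.

Lemma qGamma_part_le N M : qGamma_part (N.+1 + M) <= qGamma_approx N.+1.
Proof.
rewrite /qGamma_approx part_cat ler_pM2l//
  -[leRHS]div1r ler_pdivlMr ?powR_gt0//.
apply: le_trans (q_tail_upper _ _) _.
apply: powR_le1; rewrite ?qj_ge0/= ?lerBlDr ?lerDl ?subr_ge0 ?(ltW x1)//.
by have /andP[] := qj01 (N.+1 + M).
Qed.

(** The bound of [q_tail_lower] involves x through a = q^x. Since q <= a < 1 and 0 <= 1 - x <= 1, it
    weakens to quantities free of x; the factor 1 - q^M disappears as M grows. *)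
Lemma qGamma_part_ge N M :
  qGamma_approx N.+1 * ((1 - q ^+ N.+1) / (1 - q ^+ N.+2)) * (1 - q ^+ M) <=
  qGamma_part (N.+1 + M).
Proof.
rewrite /qGamma_approx part_cat -mulrA.
have x1' : 0 <= 1 - x by rewrite subr_ge0 ltW.
have y1' : 1 - x <= 1 by rewrite lerBlDr lerDl ltW.
set A := 1 - q ^+ N.+1; set B := 1 - a * q ^+ N.+1.
have A0 : 0 < A by exact: qj_gt0.
have B0 : 0 < B by exact: aqj_gt0.
have AB : A / (1 - q ^+ N.+2) <= (A / B) `^ (1 - x).
  apply: (@le_trans _ _ (A / B)).
    rewrite ler_wpM2l ?(ltW A0)// lef_pV2 ?posrE// lerB// exprS.
    by rewrite ler_wpM2r// exprn_ge0 ?(ltW q0).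
  apply: ger1_powR => //; rewrite divr_gt0//= ler_pdivrMr// mul1r lerB//.
  by rewrite ler_piMl ?exprn_ge0 ?(ltW q0) ?(ltW a1).
have T_ge : 1 - q ^+ M <=
    \prod_(N.+1 <= j < N.+1 + M) q_ratio j * B `^ (1 - x).
  apply: le_trans (q_tail_lower N.+1 M).
  apply: (@le_trans _ _ (1 - a * q ^+ (N.+1 + M))).
    rewrite lerB// exprD mulrA ler_piMl ?exprn_ge0 ?(ltW q0)//.
    by have /andP[] := aqj01 N.+1.
  apply: ger1_powR => //; rewrite aqj_gt0/= lerBlDr lerDl.
  by have /andP[] := aqj01 (N.+1 + M).
move: T_ge; set T := \prod_(_ <= _ < _) _ => T_ge.
have pA : 0 < qGamma_part N.+1 / A `^ (1 - x) by rewrite divr_gt0 ?powR_gt0.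
have -> : qGamma_part N.+1 * T = qGamma_part N.+1 / A `^ (1 - x) *
    ((A / B) `^ (1 - x) * (T * B `^ (1 - x))).
  rewrite powR_div ?(ltW A0) ?(ltW B0)//.
  have := powR_gt0 (1 - x) A0; have := powR_gt0 (1 - x) B0.
  move: (A `^ _) (B `^ _) => A' B' B'0 A'0.
  by field; rewrite !gt_eqF.
rewrite ler_pM2l// ler_pM ?divr_ge0 ?(ltW A0) ?(ltW (qj_gt0 _))//.
Qed.

End tail.

(** This is the difference quotient of q^c at q = 1; Caratheodory's form of the derivative gives it
    as a continuous function. *)
Lemma cvg_q_bracket (c : R) :
  (1 - q `^ c) / (1 - q) @[q --> (1 : R)^'-] --> c.
Proof.
have /is_derive1_caratheodory[g [gE cg g1]] := @is_derive1_powR R c 1 ltr01.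
have {}g1 : g 1 = c by rewrite g1 powR1 mulr1.
have : g q @[q --> (1 : R)^'-] --> c by rewrite -g1; exact: cvg_at_left_filter.
apply: cvg_trans; apply: near_eq_cvg; near=> q.
have := gE q; rewrite powR1 => gq.
have q1 : q < 1 by near: q; exact: nbhs_left_lt.
rewrite -opprB -[in X in _ / X]opprB gq invrN mulrNN mulfK// subr_eq0.
by rewrite lt_eqF.
Unshelve. all: by end_near. Qed.

(** Dividing every 1 - q^c by 1 - q leaves finitely many q-brackets: the added factors cancel within
    each ratio, and (1 - q)^(1-x) is absorbed by the bracket of N + 1. *)
Lemma cvg_qGamma_approx (x : R) N : 0 < x < 1 ->
  qGamma_approx q x N.+1 @[q --> (1 : R)^'-] --> Gamma_approx x N.+1.
Proof.
move=> /andP[x0 x1].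
pose br c (q : R) : R := (1 - q `^ c) / (1 - q).
have : (\prod_(0 <= j < N.+1) (br j.+1%:R q / br (x + j%:R) q)) *
    (br N.+1%:R q) `^ (x - 1) @[q --> (1 : R)^'-] --> Gamma_approx x N.+1.
  rewrite /Gamma_approx; apply: cvgM.
    rewrite natr_fact -prodf_div; apply: cvg_big_prod => j _.
    apply: cvgM; first exact: cvg_q_bracket.
    apply: cvgV; last exact: cvg_q_bracket.
    by rewrite gt_eqF// ltr_wpDr.
  have N0 : 0 < N.+1%:R :> R by rewrite ltr0n.
  exact: (continuous_cvg _ (@continuous_powRl R (x - 1) _ N0)
    (@cvg_q_bracket N.+1%:R)).
apply: cvg_trans; apply: near_eq_cvg; near=> q.
have q1 : q < 1 by near: q; exact: nbhs_left_lt.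
have q0 : 0 < q by near: q; exact: nbhs_left_gt.
have qn1 : 0 < 1 - q by rewrite subr_gt0.
rewrite /qGamma_approx /qGamma_part /br powR_div ?(ltW qn1)//; last first.
  by rewrite subr_ge0 powR_mulrn ?(ltW q0)// exprn_ile1 ?(ltW q0) ?(ltW q1).
rewrite powR_mulrn ?(ltW q0)// -[x - 1]opprB !powRN -mulrA; congr (_ * _).
  apply: eq_bigr => j _; rewrite /q_ratio powR_mulrn ?(ltW q0)//.
  rewrite powRD ?(gt_eqF q0) ?implybT// powR_mulrn ?(ltW q0)//.
  by rewrite -mulf_div divff ?mulr1 ?invr_neq0 ?gt_eqF.
by rewrite invrK mulrC.
Unshelve. all: by end_near. Qed.

End real_q.

(** * The limit q -> 1 *)

Section classical_limit.
Variable R : realType.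

Lemma cvg_Re (T : Type) (F : set_system T) {FF : Filter F} (f : T ->
  R[i]) (z : R[i]) :
  (f : T -> (R[i])^o) @ F --> (z : (R[i])^o) ->
  complex.Re (f t) @[t --> F] --> complex.Re z.
Proof.
move=> fz; apply/cvgrPdist_lt => e e0.
have e0' : 0 < e%:C :> R[i] by rewrite ltcR.
move/cvgrPdist_lt : fz => /(_ _ e0'); apply: filterS => t.
rewrite [`|_|]norm_normc ltcR; apply: le_lt_trans.
by apply: le_trans (Re_le_normc _); case: (z) (f t) => a b [c d].
Qed.

Lemma cvg_Im (T : Type) (F : set_system T) {FF : Filter F} (f : T ->
  R[i]) (z : R[i]) :
  (f : T -> (R[i])^o) @ F --> (z : (R[i])^o) ->
  complex.Im (f t) @[t --> F] --> complex.Im z.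
Proof.
move=> fz; apply/cvgrPdist_lt => e e0.
have e0' : 0 < e%:C :> R[i] by rewrite ltcR.
move/cvgrPdist_lt : fz => /(_ _ e0'); apply: filterS => t.
rewrite [`|_|]norm_normc ltcR; apply: le_lt_trans.
by apply: le_trans (Im_le_normc _); case: (z) (f t) => a b [c d].
Qed.

Lemma cpow_real (r c : R) : 0 < r -> cpow r%:C c%:C = (r `^ c)%:C.
Proof.
move=> r0; have -> : cpow r%:C c%:C = cexp (c * ln r)%:C.
  rewrite /cpow /clog /carg /= expr0n /= addr0 sqrtr_sqr gtr0_norm// lexx.
  rewrite divff ?gt_eqF// acos1; congr cexp; apply/eqP; rewrite eq_complex /=.
  by rewrite !(mulr0, mul0r, subr0, addr0) !eqxx.
rewrite /cexp /= cos0 sin0 /powR gt_eqF//.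
by apply/eqP; rewrite eq_complex /= !(mulr0, mul0r, mulr1, subr0, addr0) !eqxx.
Qed.

Lemma cvg_quotientM (K : numFieldType) (u v : K^nat) (A B c : K) :
  B != 0 -> u @ \oo --> A -> v @ \oo --> B ->
  u n / v n * c @[n --> \oo] --> A / B * c.
Proof.
move=> B0 uA vB; apply: cvgM; last exact: cvg_cst.
by apply: cvgM => //; exact: cvgV.
Qed.

Section fixed_q.
Variables (q x : R).
Hypotheses (q01 : 0 < q < 1) (x01 : 0 < x < 1).

Let q0 : 0 < q. Proof. by case/andP: q01. Qed.
Let q1 : q < 1. Proof. by case/andP: q01. Qed.

Lemma cvg_qGamma_part :
  (fun m => (qGamma_part q x m)%:C : (R[i])^o) @ \oo -->
  (qGamma (tau_of q) x%:C : (R[i])^o).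
Proof.
have x0 : 0 < x by case/andP: x01.
have nq : normc q%:C < 1 by rewrite normc_real gtr0_norm.
have a0 : 0 < q `^ x by rewrite powR_gt0.
have na : normc (q `^ x)%:C < 1.
  rewrite normc_real gtr0_norm//.
  have <- : (1 : R) `^ x = 1 by rewrite powR1.
  by rewrite gt0_ltr_powR// ?nnegrE// ltW.
have q1E : qpow (tau_of q) 1 = q%:C.
  by rewrite -[q in RHS]powRr1 ?(ltW q0)// -qpow_tau_of.
rewrite /qGamma q1E qpow_tau_of//.
have -> : cpow (1 - q%:C) (1 - x%:C) = ((1 - q) `^ (1 - x))%:C.
  by rewrite -cpow_real ?subr_gt0// !rmorphB.
rewrite (_ : (fun m => _) = fun m => qpoch_part q%:C q%:C m /
    qpoch_part (q `^ x)%:C q%:C m * ((1 - q) `^ (1 - x))%:C).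
  apply: (@cvg_quotientM R[i]); first exact: qpoch_neq0.
    exact: cvg_qpoch_part.
  exact: cvg_qpoch_part.
apply/funext => m; rewrite /qGamma_part rmorphM /= rmorph_prod /qpoch_part.
rewrite -prodf_div; congr (_ * _); apply: eq_bigr => j _.
by rewrite /q_ratio rmorphM fmorphV !rmorphB !rmorphM !rmorphXn exprS.
Qed.

(** The partial products are real, so their limit has imaginary part 0. *)
Lemma qGamma_real : qGamma (tau_of q) x%:C =
  (complex.Re (qGamma (tau_of q) x%:C))%:C.
Proof.
have im : (0 : R) @[_ --> \oo] --> complex.Im (qGamma (tau_of q) x%:C).
  exact: (cvg_Im cvg_qGamma_part).
have := cvg_unique (@Rhausdorff R) im (cvg_cst (0 : R)).
by case: (qGamma _ _) => a b /= ->.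
Qed.

Lemma Re_qGamma_bounds N :
  qGamma_approx q x N.+1 * ((1 - q ^+ N.+1) / (1 - q ^+ N.+2)) <=
  complex.Re (qGamma (tau_of q) x%:C) <= qGamma_approx q x N.+1.
Proof.
have re : qGamma_part q x (M + N.+1) @[M --> \oo] -->
    complex.Re (qGamma (tau_of q) x%:C).
  rewrite (cvg_shiftn N.+1 (qGamma_part q x)).
  exact: (cvg_Re cvg_qGamma_part).
apply/andP; split; last first.
  apply: (ler_cvg_to re (cvg_cst _)); apply: nearW => M.
  by rewrite addnC; exact: qGamma_part_le.
have qm : geometric 1 q @ \oo --> (0 : R).
  by apply: cvg_geometric; rewrite gtr0_norm.
set L := _ * (_ / _).
have cL : L * (1 - geometric 1 q M) @[M --> \oo] --> L * (1 - 0).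
  apply: cvgM; first exact: cvg_cst.
  by apply: cvgB => //; exact: cvg_cst.
rewrite -[L]mulr1 -[X in L * X](subr0 1).
apply: (ler_cvg_to cL re); apply: nearW => M /=.
by rewrite mul1r addnC; exact: qGamma_part_ge.
Qed.

End fixed_q.

Lemma cvg_q_ratio (N : nat) : (1 - q ^+ N.+1) / (1 - q ^+ N.+2)
  @[q --> (1 : R)^'-] --> (N.+1%:R / N.+2%:R : R).
Proof.
have : ((1 - q `^ N.+1%:R) / (1 - q)) / ((1 - q `^ N.+2%:R) / (1 - q))
    @[q --> (1 : R)^'-] --> (N.+1%:R / N.+2%:R : R).
  apply: cvgM; first exact: cvg_q_bracket.
  by apply: cvgV; [rewrite pnatr_eq0|exact: cvg_q_bracket].
apply: cvg_trans; apply: near_eq_cvg; near=> q.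
have q1 : q < 1 by near: q; exact: nbhs_left_lt.
have q0 : 0 < q by near: q; exact: nbhs_left_gt.
rewrite !powR_mulrn ?(ltW q0)// -mulf_div divff ?mulr1//.
by rewrite invr_neq0// subr_eq0 gt_eqF.
Unshelve. all: by end_near. Qed.

Lemma cvg_Re_qGamma (x : R) : 0 < x < 1 ->
  complex.Re (qGamma (tau_of q) x%:C) @[q --> (1 : R)^'-] --> Euler_Gamma x.
Proof.
move=> x01; set G := Euler_Gamma x; apply/cvgrPdist_lt => e e0.
have G0 : 0 <= G by rewrite /G Euler_GammaE fine_ge0// eGamma_ge0.
(* The errors of the upper and the lower bound are at most G/(N + 1) and G/(N + 2), so this one [N]
   serves both. *)
have [N GN] : exists N : nat, G / N.+1%:R < e.
  exists (Num.truncn (G / e)).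
  by rewrite ltr_pdivrMr ?ltr0n// mulrC -ltr_pdivrMr// truncnS_gt.
have cA := @cvg_qGamma_approx R x N x01.
have hi : Gamma_approx x N.+1 < G + e.
  apply: le_lt_trans (Gamma_approx_le N x01) _.
  by rewrite mulrDr mulr1 ltrD2l.
have lo : G - e < Gamma_approx x N.+1 * (N.+1%:R / N.+2%:R).
  apply: (@lt_le_trans _ _ (G * (N.+1%:R / N.+2%:R))); last first.
    by rewrite ler_wpM2r ?divr_ge0 ?ler0n// Gamma_approx_ge.
  have -> : N.+1%:R / N.+2%:R = 1 - N.+2%:R^-1 :> R.
    have N2 : N.+2%:R != 0 :> R by rewrite pnatr_eq0.
    by apply: (mulIf N2); rewrite mulrBl mulVf// divfK//
      mul1r -[N.+2%:R]natr1 addrK.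
  rewrite mulrBr mulr1 ltrD2l ltrN2; apply: le_lt_trans GN.
  by rewrite ler_wpM2l// lef_pV2 ?posrE ?ltr0n// ler_nat.
have cL : qGamma_approx q x N.+1 * ((1 - q ^+ N.+1) / (1 - q ^+ N.+2))
    @[q --> (1 : R)^'-] --> Gamma_approx x N.+1 * (N.+1%:R / N.+2%:R).
  by apply: cvgM; [exact: cA|exact: cvg_q_ratio].
near=> q.
have q01 : 0 < q < 1.
  by apply/andP; split; near: q; [exact: nbhs_left_gt|exact: nbhs_left_lt].
have /andP[h1 h2] := Re_qGamma_bounds q01 x01 N.
rewrite ltr_distlC; apply/andP; split.
  apply: lt_le_trans h1; near: q; exact: (cvgr_gt _ cL).
apply: le_lt_trans h2 _; near: q; exact: (cvgr_lt _ cA).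
Unshelve. all: by end_near. Qed.

Lemma cvg_qGamma (x : R) : 0 < x < 1 ->
  (qGamma (tau_of q) x%:C : (R[i])^o) @[q --> (1 : R)^'-] -->
  ((Euler_Gamma x)%:C : (R[i])^o).
Proof.
move=> x01; apply: cvg_trans (cvg_real_complex (cvg_Re_qGamma x01)).
apply: near_eq_cvg; near=> q.
rewrite -qGamma_real//; apply/andP.
by split; near: q; [exact: nbhs_left_gt|exact: nbhs_left_lt].
Unshelve. all: by end_near. Qed.

End classical_limit.

Theorem theorem2p1 (R : realType) (n : nat) (hn : (0 < n)%N) :
  [/\ (forall tau : R[i], 0 < complex.Im tau ->
         \prod_(1 <= k < n) qGamma tau (k%:R / n%:R) = qGauss_rhs n tau),
      \prod_(1 <= k < n) Euler_Gamma (k%:R / n%:R : R) = Gauss_value R n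
    & (qGauss_rhs n (tau_of q) : (R[i])^o) @[q --> (1 : R)^'-] -->
        ((Gauss_value R n)%:C : (R[i])^o)].
Proof.
have product (tau : R[i]) := @qGamma_product R tau ^~ n.
split; [by move=> tau tau0; exact: product|exact: Gauss_product_Euler_Gamma|].
have cP : \prod_(1 <= k < n) qGamma (tau_of q) (k%:R / n%:R : R)%:C
    @[q --> (1 : R)^'-] -->
    (\prod_(1 <= k < n) (Euler_Gamma (k%:R / n%:R : R))%:C : (R[i])^o).
  rewrite big_nat; under eq_fun do rewrite big_nat.
  apply: (@cvg_big_prod R[i]) => k /andP[k1 kn]; apply: cvg_qGamma.
  by rewrite divr_gt0 ?ltr0n//= ltr_pdivrMr ?ltr0n// mul1r ltr_nat.
rewrite -(Gauss_product_Euler_Gamma R hn) rmorph_prod.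
apply: cvg_trans cP; apply: near_eq_cvg; near=> q.
have q1 : q < 1 by near: q; exact: nbhs_left_lt.
have q0 : 0 < q by near: q; exact: nbhs_left_gt.
(* For 0 < q < 1 the number [tau_of q] lies in the upper half-plane, so the product formula applies
   there. *)
rewrite -product//.
  apply: eq_bigr => k _; congr (qGamma _ _).
  by rewrite rmorphM fmorphV !rmorph_nat.
by rewrite /= divr_gt0 ?pi_gt0// oppr_gt0 ln_lt0// q0.
Unshelve. all: by end_near. Qed.
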